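(* Let $k$ be an algebraically closed field, let $S$ be a one-dimensional homogeneous Cohen-Macaulay graded ring over $k$ with minimal multiplicity, let $f$ be a homogeneous non-zero divisor of $S$ of degree two, and let $R= S/fS$. Assume that $R$ is not Gorenstein. Let $V$ be the $k$-vector space consisting of the elements of degree one of $R$ (so $\dim_k V=r+1$, where $r$ is the socle dimension of $R$), and let $\mathbb P(V)$ be the projective space over $V$, i.e. the set of one-dimensional $k$-linear subspaces of $V$. Then there are a non-empty (Zariski) open subset $\mathcal O$ of $\mathbb P(V)$ and $R$-modules $M(p,n)$, one for each $(p,n)\in\mathcal O\times\mathbb N$, satisfying the following conditions: (1) Each $M(p,n)$ is an indecomposable $R$-module that is minimally generated by $n$ elements. (2) $\mathrm{G}\text{-}\dim_R M(p,n)=0$ for any $(p,n)\in\mathcal O\times\mathbb N$. (3) If $(p,n)\neq(p',n')$ in $\mathcal O\times\mathbb N$, then $M(p,n)$ and $M(p',n')$ are non-isomorphic.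
   Context: Here $\mathbb N=\{1,2,3,\dots\}$. A homogeneous graded ring over $k$ is a residue ring of a polynomial ring over $k$ in finitely many variables, all of degree one, by a homogeneous ideal; its graded maximal ideal is generated by the elements of positive degree. A Cohen-Macaulay ring $S$ with (graded) maximal ideal $\mathfrak n$ has minimal multiplicity if there is a system of parameters $\underline x=x_1,\dots,x_d$ with $\underline x\,\mathfrak n=\mathfrak n^2$. All modules are finitely generated. The socle dimension of $R$ is $\dim_k\mathrm{Hom}_R(k,R)$, where $k=R/\mathfrak m$ and $\mathfrak m$ is the graded maximal ideal of $R$. A finitely generated $R$-module $M$ has G-dimension zero if (i) the natural map $M\to \mathrm{Hom}_R(\mathrm{Hom}_R(M,R),R)$ is an isomorphism, (ii) $\mathrm{Ext}^i_R(M,R)=0$ for all $i>0$, and (iii) $\mathrm{Ext}^i_R(\mathrm{Hom}_R(M,R),R)=0$ for all $i>0$. *)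

(* Defs.v *)
From HB Require Import structures.
From mathcomp Require Import all_boot all_order all_algebra.
From mathcomp Require Import mathcomp_extra boolp classical_sets functions.
From mathcomp.multinomials Require Import mpoly.

Set Implicit Arguments.
Unset Strict Implicit.
Unset Printing Implicit Defensive.
Import GRing.Theory.
Local Open Scope classical_set_scope.
Local Open Scope ring_scope.

Section Ideals.
Variable S : comNzRingType.
Implicit Types A I J : set S.

Definition ideal_gen A : set S :=
  [set s | exists (m : nat) (a b : 'I_m -> S),
     (forall i, A (b i)) /\ s = \sum_(i < m) a i * b i].

Definition ideal_mul I J : set S :=
  ideal_gen [set a * b | a in I & b in J].

Definition ideal_pow I (m : nat) : set S := iter m (ideal_mul I) setT.

Definition prime_ideal (P : {pred S}) : Prop :=
  idealr_closed P /\ prime_idealr_closed P.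

Definition has_prime_chain (d : nat) : Prop :=
  exists P : nat -> {pred S},
    (forall i, (i <= d)%N -> prime_ideal (P i)) /\
    (forall i, (i < d)%N -> [set` P i] `<` [set` P i.+1]).

Definition krull_dim (d : nat) : Prop :=
  has_prime_chain d /\ forall e, has_prime_chain e -> (e <= d)%N.

Definition regular_sequence (x : seq S) : Prop :=
  ~ ideal_gen [set` x] 1 /\
  forall i, (i < size x)%N -> forall s,
    ideal_gen [set` take i x] (x`_i * s) -> ideal_gen [set` take i x] s.

(* the grade of I on S; for the graded maximal ideal this is depth S *)
Definition grade I (d : nat) : Prop :=
  (exists x : d.-tuple S, [set` x] `<=` I /\ regular_sequence x) /\
  (forall x : seq S, [set` x] `<=` I -> regular_sequence x -> (size x <= d)%N).

End Ideals.

(* A graded k-algebra A is given by a map pi from a polynomial ring onto it;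
   pi is also used for the grading it induces. *)
Section Graded.
Variables (k : fieldType) (N : nat) (A : comAlgType k).
Implicit Type pi : {mpoly k[N]} -> A.

Definition homogeneous_graded_ring pi : Prop :=
  (forall a, exists p, pi p = a) /\
  (forall p, pi p = 0 -> forall d, pi (pihomog mdeg d p) = 0).

Definition graded_piece pi (d : nat) : set A :=
  [set pi p | p in [set p | p \is d.-homog]].

Definition graded_max_ideal pi : set A :=
  ideal_gen [set a | exists2 d, (0 < d)%N & graded_piece pi d a].

Definition cohen_macaulay pi : Prop :=
  exists2 d, krull_dim A d & grade (graded_max_ideal pi) d.

(* The elements are in the graded maximal ideal, there are dim A of them, and
   they generate an ideal primary to it; they need not be homogeneous. *)
Definition system_of_parameters pi (d : nat) (x : d.-tuple A) : Prop :=
  [/\ krull_dim A d, [set` x] `<=` graded_max_ideal pi &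
      exists m, ideal_pow (graded_max_ideal pi) m `<=` ideal_gen [set` x]].

Definition minimal_multiplicity pi : Prop :=
  exists (d : nat) (x : d.-tuple A), system_of_parameters pi x /\
    ideal_mul (ideal_gen [set` x]) (graded_max_ideal pi) =
    ideal_mul (graded_max_ideal pi) (graded_max_ideal pi).

End Graded.

Section Dual.
Variables (R : comNzRingType) (M : lmodType R).

Definition linear_pred : {pred M -> R^o} := fun f => `[< linear f >].

Lemma linear_pred_submod : submod_closed linear_pred.
Proof.
split=> [|a f g /asboolP fl /asboolP gl]; apply/asboolP => c x y.
  by rewrite /= scaler0 addr0.
rewrite !fctE fl gl !scalerDr !scalerA [a * c]mulrC -!addrA.
by congr (_ + _); rewrite addrCA.
Qed.

HB.instance Definition _ :=
  GRing.isSubmodClosed.Build R (M -> R^o) linear_pred linear_pred_submod.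

(* Hom_R(M, R), with the pointwise module structure *)
Record dual := Dual { dual_fun :> M -> R^o; _ : dual_fun \in linear_pred }.

HB.instance Definition _ := [isSub for dual_fun].
HB.instance Definition _ := [Choice of dual by <:].
HB.instance Definition _ := [SubChoice_isSubLmodule of dual by <:].

End Dual.

Section Biduality.
Variables (R : comNzRingType) (M : lmodType R).

Lemma eval_linear (x : M) :
  (fun phi : dual M => phi x : R^o) \in @linear_pred R (dual M).
Proof. by apply/asboolP. Qed.

Definition biduality (x : M) : dual (dual M) := Dual (eval_linear x).

End Biduality.

Section Modules.
Variable R : comNzRingType.

Definition isomorphic (A B : lmodType R) : Prop :=
  exists h : {linear A -> B}, bijective h.

Definition generated_by (M : lmodType R) (n : nat) : Prop :=
  exists g : 'I_n -> M, forall x, exists c : 'I_n -> R,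
    x = \sum_(i < n) c i *: g i.

Definition minimally_generated_by (M : lmodType R) (n : nat) : Prop :=
  generated_by M n /\ forall m, generated_by M m -> (n <= m)%N.

Definition indecomposable (M : lmodType R) : Prop :=
  (exists x : M, x <> 0) /\
  forall A B : lmodType R, isomorphic M (A * B)%type ->
    (forall a : A, a = 0) \/ (forall b : B, b = 0).

Definition projective_module (P : lmodType R) : Prop :=
  forall (A B : lmodType R) (q : {linear A -> B}) (g : {linear P -> B}),
    (forall b, exists a, q a = b) ->
    exists h : {linear P -> A}, forall x, q (h x) = g x.

Definition injective_module (E : lmodType R) : Prop :=
  forall (A B : lmodType R) (j : {linear A -> B}) (g : {linear A -> E}),
    injective j -> exists h : {linear B -> E}, forall x, h (j x) = g x.

Definition exact_at (A B C : lmodType R)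
  (u : {linear A -> B}) (v : {linear B -> C}) : Prop :=
  forall y, v y = 0 <-> exists x, u x = y.

Fixpoint injective_dim_le (n : nat) (M : lmodType R) : Prop :=
  injective_module M \/
  if n is m.+1 then
    exists (E C : lmodType R) (u : {linear M -> E}) (v : {linear E -> C}),
      [/\ injective_module E, injective u, exact_at u v,
          (forall c, exists x, v x = c) & injective_dim_le m C]
  else False.

Definition projective_resolution (M : lmodType R) (P : nat -> lmodType R)
  (d : forall i, {linear P i.+1 -> P i}) (e : {linear P 0%N -> M}) : Prop :=
  [/\ (forall i, projective_module (P i)), (forall x, exists y, e y = x),
      exact_at (d 0%N) e & forall i, exact_at (d i.+1) (d i)].

Definition coboundary (P : nat -> lmodType R)
  (d : forall i, {linear P i.+1 -> P i}) (L : lmodType R) (i : nat) :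
  {linear P i -> L} -> Prop :=
  match i with
  | 0%N => fun phi => forall x, phi x = 0
  | j.+1 => fun phi => exists psi : {linear P j -> L},
                         forall x, phi x = psi (d j x)
  end.

(* Ext^i_R(M, L) = 0, i.e. the complex Hom_R(P, L) is exact in degree i, where
   P is a projective resolution of M; the choice of P is immaterial. *)
Definition ext_zero (i : nat) (M L : lmodType R) : Prop :=
  exists (P : nat -> lmodType R) (d : forall j, {linear P j.+1 -> P j})
         (e : {linear P 0%N -> M}),
    projective_resolution d e /\
    forall phi : {linear P i -> L},
      (forall x, phi (d i x) = 0) -> coboundary d phi.

Definition gdim_zero (M : lmodType R) : Prop :=
  [/\ bijective (@biduality R M),
      (forall i, (0 < i)%N -> ext_zero i M R^o) &
      (forall i, (0 < i)%N -> ext_zero i (dual M) R^o)].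

End Modules.

(* the definition for Noetherian local rings *)
Definition gorenstein (R : comNzRingType) : Prop :=
  exists n, injective_dim_le n (R^o : lmodType R).

(* k-linear algebra inside an R-module, k acting through k -> R *)
Section OverField.
Variables (k : fieldType) (R : comAlgType k) (U : lmodType R).
Implicit Types W p : set U.

Definition lin_comb (m : nat) (b : 'I_m -> U) (c : 'I_m -> k) : U :=
  \sum_(i < m) (c i)%:A *: b i.

Definition is_basis W (m : nat) (b : 'I_m -> U) : Prop :=
  W = range (lin_comb b) /\
  forall c, lin_comb b c = 0 -> forall i, c i = 0.

Definition has_dim W (m : nat) : Prop := exists b : 'I_m -> U, is_basis W b.

Definition projective_space W : set (set U) :=
  [set p | p `<=` W /\ has_dim p 1].

(* zero loci of families of homogeneous polynomials in the coordinates with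
   respect to a basis of W (the choice of the basis is immaterial) *)
Definition zariski_closed W (Z : set (set U)) : Prop :=
  exists (m : nat) (b : 'I_m -> U) (F : set {mpoly k[m]}),
    [/\ is_basis W b,
        (forall g, F g -> exists d, g \is d.-homog) &
        Z = [set p | projective_space W p /\
               forall g c, F g -> p (lin_comb b c) -> g.@[c] = 0]].

Definition zariski_open W (O : set (set U)) : Prop :=
  O `<=` projective_space W /\ zariski_closed W (projective_space W `\` O).

End OverField.

(* r = dim_k Hom_R(k, R), where K is the R-module k = R/m *)
Definition socle_dim (k : fieldType) (N : nat) (R : comAlgType k)
  (pi : {mpoly k[N]} -> R) (r : nat) : Prop :=
  exists (K : lmodType R) (q : {linear R^o -> K}),
    [/\ (forall y, exists x, q x = y),
        [set x | q x = 0] = graded_max_ideal pi &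
        has_dim [set: dual K] r].

(* Main.v *)
(** Let [x] be the linear part of a reduction of the maximal ideal of [S], so
    that [x S_1 = S_2]. As [f = x y] is regular, so are [x] and [y], all [S_i]
    with [i > 0] have the same dimension [r + 1], and [R] lives in degrees 0, 1
    and 2, with dimensions 1, [r + 1] and [r]; moreover [r > 0], since for [r = 0]
    the ring [R] is [k[v]/(v^2)], which is self-injective.

    The open set consists of the lines spanned by the elements [t] of degree one
    with [t S_1 = S_2], a determinantal condition. Given such a [t] and a linear
    form [z] independent of [t], let [A = t + z N] with [N] the nilpotent shift of
    size [n]. Dividing repeatedly by [t], the matrix [B = f A^-1] has linear
    entries in [S], so that [(A, B)] is a matrix factorization of [f]; the
    cokernel of [A] over [R] has a 2-periodic resolution which stays exact under
    duality. A homomorphism between two such cokernels lifts to matrices with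
    [P A = A' Q], and linear forms on [R_1] turn this into identities over [k]:
    endomorphisms commute with [N] modulo the maximal ideal, and an isomorphism
    forces [t] and [t'] to be proportional. *)

Require Import Defs.
From HB Require Import structures.
From mathcomp Require Import all_boot all_order all_algebra.
From mathcomp Require Import mathcomp_extra boolp classical_sets functions.
From mathcomp.multinomials Require Import mpoly.

Set Implicit Arguments.
Unset Strict Implicit.
Unset Printing Implicit Defensive.
Import GRing.Theory.
Local Open Scope classical_set_scope.
Local Open Scope ring_scope.

(** * Homogeneous components *)

Section HomogeneousComponents.
Variables (k : fieldType) (N : nat) (A : comAlgType k).
Variable pi : {lrmorphism {mpoly k[N]} -> A}.
Hypothesis pi_graded : homogeneous_graded_ring pi.

Definition poly_lift (a : A) : {mpoly k[N]} := xget 0 [set p | pi p = a].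

Lemma poly_liftK a : pi (poly_lift a) = a.
Proof.
by have [p ap] := pi_graded.1 a; rewrite /poly_lift; case: xgetP => [q _ //|/(_ p)].
Qed.

Definition hcomp (d : nat) (a : A) : A := pi (pihomog mdeg d (poly_lift a)).

(** The kernel of [pi] is stable under taking components, so a component computed on the chosen lift
    does not depend on that lift. *)
Lemma hcomp_pi d p : hcomp d (pi p) = pi (pihomog mdeg d p).
Proof.
apply/eqP; rewrite -subr_eq0 -!raddfB /=; apply/eqP/pi_graded.2.
by rewrite raddfB /= poly_liftK subrr.
Qed.

Lemma hcomp_is_linear d : linear (hcomp d).
Proof.
move=> c a b; rewrite -[a]poly_liftK -[b]poly_liftK -linearP !hcomp_pi.
by rewrite !linearP.
Qed.

HB.instance Definition _ d :=
  GRing.isLinear.Build k A A *:%R (hcomp d) (hcomp_is_linear d).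

Lemma hcomp_piece d e a : graded_piece pi d a -> hcomp e a = if e == d then a else 0.
Proof.
case=> p /= ph <-; rewrite hcomp_pi; case: eqP => [->|/eqP ne].
  by rewrite pihomog_dE.
by rewrite (pihomog_ne0 _ ph) ?raddf0 // eq_sym.
Qed.

Lemma hcompP d a : graded_piece pi d (hcomp d a).
Proof. by exists (pihomog mdeg d (poly_lift a)) => //=; exact: pihomogP. Qed.

Lemma pieceP d a : graded_piece pi d a <-> hcomp d a = a.
Proof. by split=> [/hcomp_piece->|<-]; [rewrite eqxx | exact: hcompP]. Qed.

Lemma pieceD d a b : graded_piece pi d a -> graded_piece pi d b -> graded_piece pi d (a + b).
Proof. by move=> /pieceP ha /pieceP hb; apply/pieceP; rewrite raddfD /= ha hb. Qed.

Lemma piece0 d : graded_piece pi d 0.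
Proof. by apply/pieceP; rewrite raddf0. Qed.

Lemma pieceZ d c a : graded_piece pi d a -> graded_piece pi d (c *: a).
Proof. by move=> /pieceP ha; apply/pieceP; rewrite linearZ /= ha. Qed.

Lemma piece_sum d (I : Type) (r : seq I) (P : pred I) (F : I -> A) :
  (forall i, P i -> graded_piece pi d (F i)) ->
  graded_piece pi d (\sum_(i <- r | P i) F i).
Proof. by move=> h; apply: big_ind => //; [exact: piece0|exact: pieceD]. Qed.

Lemma pieceM d e a b :
  graded_piece pi d a -> graded_piece pi e b -> graded_piece pi (d + e) (a * b).
Proof.
move=> [p /= hp <-] [q /= hq <-]; exists (p * q); last by rewrite rmorphM.
exact: dhomogM.
Qed.

(** The length is left open upwards, so that the sum can be made to contain any index that a proof
    needs. *)
Lemma hcomp_sum a :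
  exists n, forall m, (n <= m)%N -> a = \sum_(d < m) hcomp d a.
Proof.
exists (mmeasure mdeg (poly_lift a)) => m le_m.
rewrite -{1}[a]poly_liftK {1}(pihomog_partitionE le_m) raddf_sum.
by apply: eq_bigr => i _.
Qed.

Lemma hcompM e a h d : graded_piece pi e h ->
  hcomp d (a * h) = if (e <= d)%N then hcomp (d - e) a * h else 0.
Proof.
move=> hh; have [n an] := hcomp_sum a.
pose m := maxn n d.+1; rewrite {1}(an m) ?leq_maxl // mulr_suml raddf_sum /=.
have term (i : nat) : hcomp d (hcomp i a * h) =
    if (i + e == d)%N then hcomp i a * h else 0.
  by rewrite (hcomp_piece d (pieceM (hcompP i a) hh)) eq_sym.
case: leqP => [le_ed|lt_de].
  have lt_m : (d - e < m)%N by rewrite leq_max ltnS leq_subr orbT.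
  rewrite (bigD1 (Ordinal lt_m)) //= term subnK // eqxx big1 ?addr0 // => i.
  by rewrite -val_eqE /= => ne; rewrite term; case: eqP => // ed; rewrite -ed addnK eqxx in ne.
rewrite big1 // => i _; rewrite term; case: eqP => // ed.
by rewrite -ed ltnNge leq_addl in lt_de.
Qed.

(** A monomial of positive degree is divisible by some variable; splitting it off is the basis of
    inductions on the degree. *)
Lemma pieceS d a : graded_piece pi d.+1 a ->
  exists q : 'I_N -> A,
    (forall i, graded_piece pi d (q i)) /\ a = \sum_i pi 'X_i * q i.
Proof.
case=> p /= hp <-.
pose P a := exists q : 'I_N -> A,
  (forall i, graded_piece pi d (q i)) /\ a = \sum_i pi 'X_i * q i.
rewrite [p]mpolyE raddf_sum big_seq; apply: (big_ind P).
- exists (fun=> 0); split=> [i|]; first exact: piece0.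
  by rewrite big1 // => i _; rewrite mulr0.
- move=> _ _ [q [hq ->]] [q' [hq' ->]]; exists (fun i => q i + q' i).
  split=> [i|]; first exact: pieceD.
  by rewrite -big_split; apply: eq_bigr => i _; rewrite mulrDr.
move=> m mp; have md : mdeg m = d.+1 by apply: (dhomogP _ _ _ hp).
have [i mi] : exists i, m i != 0%N.
  apply: contrapT => /forallNP m0.
  have : mdeg m = 0%N by rewrite mdegE big1 // => i _; apply/eqP; apply/negPn/negP/m0.
  by rewrite md.
have mE : m = (U_(i) + (m - U_(i)))%MM by rewrite addmC submK // lep1mP.
exists (fun j => if j == i then pi (p@_m *: 'X_[(m - U_(i))%MM]) else 0).
split=> [j|].
  case: eqP => _; last exact: piece0.
  exists (p@_m *: 'X_[(m - U_(i))%MM]) => //=; apply: dhomogZ; rewrite dhomogX.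
  by apply/eqP; move: md; rewrite [in mdeg m]mE mdegD mdeg1 add1n => -[].
rewrite (bigD1 i) //= eqxx big1 => [|j /negPf->]; last by rewrite mulr0.
by rewrite addr0 -rmorphM /= {2}mE mpolyXD scalerAr.
Qed.

(** The residue map from [A] to [A/m = k]; by [hcomp0] it depends only on the degree-zero
    component. *)
Definition augmentation (a : A) : k := (poly_lift a)@_0.

Lemma pihomog0C (p : {mpoly k[N]}) : pihomog mdeg 0 p = (p@_0)%:MP.
Proof.
elim/mpolyind: p => [|c m p _ _ IH]; first by rewrite raddf0 mcoeff0 mpolyC0.
rewrite (pihomog_is_linear _ _ c) IH pihomogX mcoeffD mcoeffZ mcoeffX mpolyCD mdeg_eq0.
case: eqP => [->|_]; last by rewrite scaler0 mulr0 mpolyC0.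
by rewrite mpolyX0 mulr1 -mul_mpolyC mulr1.
Qed.

Lemma algr_inj : injective (fun c : k => c%:A : A).
Proof. exact: (fmorph_inj (in_alg A)). Qed.

Lemma hcomp0 a : hcomp 0 a = (augmentation a)%:A.
Proof. by rewrite /hcomp pihomog0C -[X in pi X]mulr1 mul_mpolyC linearZ rmorph1. Qed.

Lemma augmentation_zmod : zmod_morphism augmentation.
Proof. by move=> a b; apply: algr_inj; rewrite scalerBl -!hcomp0 raddfB. Qed.

Lemma pieceC c : graded_piece pi 0 c%:A.
Proof.
exists c%:MP; first by rewrite -[_%:MP]mulr1 mul_mpolyC; apply/dhomogZ/dhomog1.
by rewrite -[_%:MP]mulr1 mul_mpolyC linearZ rmorph1.
Qed.

Lemma augmentationC c : augmentation c%:A = c.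
Proof. by apply: algr_inj; rewrite -hcomp0 (hcomp_piece _ (pieceC c)). Qed.

Lemma piece0P a : graded_piece pi 0 a -> a = (augmentation a)%:A.
Proof. by move=> /pieceP <-; rewrite hcomp0 augmentationC. Qed.

Lemma hcomp_mul d a b :
  hcomp d (a * b) = \sum_(i < d.+1) hcomp i a * hcomp (d - i) b.
Proof.
have [n an] := hcomp_sum a.
pose m := maxn n d.+1; rewrite {1}(an m) ?leq_maxl // mulr_suml raddf_sum /=.
rewrite [RHS](big_ord_widen m (fun i => hcomp i a * hcomp (d - i) b)) ?leq_maxr //.
rewrite [RHS]big_mkcond; apply: eq_bigr => i _.
by rewrite mulrC (hcompM _ _ (hcompP _ _)) ltnS; case: leqP => // _; rewrite mulrC.
Qed.

Lemma augmentation_monoid : monoid_morphism augmentation.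
Proof.
split; first by rewrite -[1]scale1r augmentationC.
move=> a b; apply: algr_inj; rewrite -hcomp0 hcomp_mul big_ord1 subn0 !hcomp0.
by rewrite -scalerAl mul1r scalerA.
Qed.

HB.instance Definition _ :=
  GRing.isZmodMorphism.Build A k augmentation augmentation_zmod.
HB.instance Definition _ :=
  GRing.isMonoidMorphism.Build A k augmentation augmentation_monoid.

Definition augmentation_rmorphism : {rmorphism A -> k} := augmentation.

Lemma augmentation_piece d a : graded_piece pi d.+1 a -> augmentation a = 0.
Proof. by move=> /(hcomp_piece 0); rewrite hcomp0 -(scale0r 1) => /algr_inj. Qed.

Lemma graded_max_idealP a : graded_max_ideal pi a <-> augmentation a = 0.
Proof.
split=> [[n [c [b [bh ->]]]]|a0].
  rewrite rmorph_sum big1 // => i _; have [[//|d] _ /augmentation_piece bi] := bh i.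
  by rewrite rmorphM /= bi mulr0.
have [n an] := hcomp_sum a; exists n, (fun=> 1), (fun i => hcomp i.+1 a).
split=> [i|]; first by exists i.+1 => //; exact: hcompP.
rewrite {1}(an n.+1) // big_ord_recl hcomp0 a0 scale0r add0r.
by apply: eq_bigr => i _; rewrite mul1r.
Qed.

(** Only the constant term of [a] contributes in degree one. Linear forms on that degree therefore
    see [a] through its residue. *)
Lemma hcomp1M a l : graded_piece pi 1 l -> hcomp 1 (a * l) = augmentation a *: l.
Proof. by move=> hl; rewrite (hcompM _ _ hl) /= hcomp0 mulr_algl. Qed.

End HomogeneousComponents.

(** * Modules of G-dimension zero from exact pairs of matrices *)

Lemma inj_surj_bijective (T U : Type) (g : T -> U) :
  injective g -> (forall u, exists t, g t = u) -> bijective g.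
Proof.
move=> g_inj /choice[g' gg']; exists g' => // t.
by apply: g_inj; rewrite gg'.
Qed.

Section ImageModule.
Variables (R : comNzRingType) (U W : lmodType R) (h : {linear U -> W}).

Definition image_pred : {pred W} := fun w => `[< exists u, h u = w >].

Lemma image_pred_submod : submod_closed image_pred.
Proof.
split=> [|a _ _ /asboolP[u <-] /asboolP[v <-]]; apply/asboolP.
  by exists 0; rewrite raddf0.
by exists (a *: u + v); rewrite linearP.
Qed.

HB.instance Definition _ :=
  GRing.isSubmodClosed.Build R W image_pred image_pred_submod.

(** Elements are vectors of [W], so equations between them are checked there. The construction
    serves for images of matrices and later for the residue field. *)
Record image_module := ImageModule { image_val :> W; _ : image_val \in image_pred }.

HB.instance Definition _ := [isSub for image_val].
HB.instance Definition _ := [Choice of image_module by <:].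
HB.instance Definition _ := [SubChoice_isSubLmodule of image_module by <:].

Lemma to_image_subproof u : h u \in image_pred.
Proof. by apply/asboolP; exists u. Qed.

Definition to_image u : image_module := ImageModule (to_image_subproof u).

Lemma to_image_is_linear : linear to_image.
Proof. by move=> a u v; apply: val_inj; rewrite /= linearP. Qed.

HB.instance Definition _ :=
  GRing.isLinear.Build R U image_module *:%R to_image to_image_is_linear.

Lemma to_image_surj w : exists u, to_image u = w.
Proof. by case: w => w wP; have /asboolP[u uw] := wP; exists u; apply: val_inj. Qed.

Lemma to_image_eq0 u : to_image u = 0 <-> h u = 0.
Proof. by split=> [/(congr1 val)|hu] //; apply: val_inj. Qed.

End ImageModule.

Section FreeColumns.
Variables (R : comNzRingType) (n : nat).

Lemma delta_expansion (v : 'cV[R]_n) : v = \sum_i v i 0 *: delta_mx i 0.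
Proof.
by rewrite {1}[v]matrix_sum_delta; apply: eq_bigr => i _; rewrite big_ord1.
Qed.

Lemma linear_cV_ext (L : lmodType R) (g h : {linear 'cV[R]_n -> L}) :
  (forall i, g (delta_mx i 0) = h (delta_mx i 0)) -> g =1 h.
Proof.
move=> gh v; rewrite [v]delta_expansion !linear_sum; apply: eq_bigr => i _.
by rewrite !linearZ gh.
Qed.

Section Extension.
Variables (L : lmodType R) (a : 'I_n -> L).

Definition cV_lin (v : 'cV[R]_n) : L := \sum_i v i 0 *: a i.

Lemma cV_lin_is_linear : linear cV_lin.
Proof.
move=> c u v; rewrite /cV_lin scaler_sumr -big_split; apply: eq_bigr => i _ /=.
by rewrite !mxE scalerDl scalerA.
Qed.

HB.instance Definition _ :=
  GRing.isLinear.Build R 'cV[R]_n L *:%R cV_lin cV_lin_is_linear.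

Lemma cV_lin_delta i : cV_lin (delta_mx i 0) = a i.
Proof.
rewrite /cV_lin (bigD1 i) //= big1 ?addr0 => [|j /negPf ne]; rewrite mxE ?ne ?scale0r //.
by rewrite !eqxx scale1r.
Qed.

End Extension.

Lemma cV_projective : projective_module 'cV[R]_n.
Proof.
move=> A B q g q_surj.
have [a aP] := choice (fun i => q_surj (g (delta_mx i 0))).
exists (cV_lin a); pose qa : {linear 'cV[R]_n -> B} := q \o cV_lin a.
by apply: (linear_cV_ext (g := qa)) => i; rewrite /qa /= cV_lin_delta.
Qed.

Lemma linear_cV_functional (g : {linear 'cV[R]_n -> R^o}) :
  exists w : 'cV[R]_n, forall v, g v = (w^T *m v) 0 0.
Proof.
exists (\col_i g (delta_mx i 0)) => v.
rewrite {1}[v]delta_expansion linear_sum mxE; apply: eq_bigr => i _.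
by rewrite linearZ !mxE mulrC.
Qed.

End FreeColumns.

(** Exactness of the 2-periodic complex of free modules with alternating maps [A] and [B]. If the
    transposes form an exact pair too, the complex is totally acyclic. *)
Definition exact_pair (R : comNzRingType) (n : nat) (A B : 'M[R]_n) : Prop :=
  (forall v : 'cV[R]_n, A *m v = 0 <-> exists u : 'cV[R]_n, B *m u = v) /\
  (forall v : 'cV[R]_n, B *m v = 0 <-> exists u : 'cV[R]_n, A *m u = v).

Section ExactPair.
Variables (R : comNzRingType) (n : nat).
Implicit Types A B : 'M[R]_n.

Lemma exact_pairC A B : exact_pair A B -> exact_pair B A.
Proof. by case. Qed.

Lemma mulmx_cV_eq (m p : nat) (A B : 'M[R]_(m, p)) :
  (forall v : 'cV[R]_p, A *m v = B *m v) -> A = B.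
Proof.
move=> AB; apply/matrixP => i j.
by have /matrixP/(_ i 0) := AB (delta_mx j 0); rewrite -!colE !mxE.
Qed.

(* The resolution of [X] alternates between [A] and [B]. *)
Lemma ext_zero_periodic A B (X : lmodType R) (e : {linear 'cV[R]_n -> X}) i :
  exact_pair A B -> exact_pair A^T B^T ->
  (forall x, exists v, e v = x) ->
  (forall v, e v = 0 <-> exists u : 'cV[R]_n, A *m u = v) ->
  (0 < i)%N -> ext_zero i X R^o.
Proof.
move=> AB ABt e_surj ker_e; case: i => // i _.
pose D j := if odd j then B else A.
pose d j : {linear 'cV[R]_n -> 'cV[R]_n} := mulmx (D j).
have DP j : exact_pair (D j) (D j.+1) by rewrite /D /=; case: (odd j) => //=; apply/exact_pairC.
have DtP j : exact_pair (D j)^T (D j.+1)^T.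
  by rewrite /D /=; case: (odd j) => //=; apply/exact_pairC.
exists (fun=> 'cV[R]_n : lmodType R), d, e; split.
  split=> //; first by move=> _; exact: cV_projective.
  by move=> j v; exact: (DP j).1.
move=> g; have [w gw] := linear_cV_functional g => g0.
(* The dual complex consists of the transposes: [w] is in the kernel of one, hence in the image of
   the other, and so [g] factors through [d i]. *)
have Dw : (D i.+1)^T *m w = 0.
  apply: trmx_inj; rewrite trmx_mul trmxK trmx0.
  apply: mulmx_cV_eq => v; rewrite mul0mx -mulmxA; apply/matrixP => a b.
  by rewrite !ord1 -gw g0 mxE.
have [u uw] := ((DtP i).2 w).1 Dw.
pose psi : {linear 'cV[R]_n -> R^o} := cV_lin (L := R^o) (fun j => u j 0).
have psiE v : psi v = (u^T *m v) 0 0.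
  by rewrite /psi /cV_lin mxE; apply: eq_bigr => j _; rewrite !mxE mulrC.
by exists psi => v; rewrite gw psiE -uw trmx_mul trmxK mulmxA.
Qed.

End ExactPair.

Section DualLinear.
Variables (R : comNzRingType) (M : lmodType R) (g : dual M).

Lemma dual_fun_is_linear : linear (dual_fun g).
Proof. by case: g => g' g'l; apply/asboolP. Qed.

HB.instance Definition _ :=
  GRing.isLinear.Build R M R^o *:%R (dual_fun g) dual_fun_is_linear.

End DualLinear.

Section ColumnModule.
Variables (R : comNzRingType) (n : nat) (A B : 'M[R]_n).

(* When (A, B) is an exact pair, the image of B is the cokernel of A. *)
Definition column_module : lmodType R :=
  image_module (mulmx B : {linear 'cV[R]_n -> 'cV[R]_n}).

Definition to_column : {linear 'cV[R]_n -> column_module} :=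
  to_image (mulmx B : {linear 'cV[R]_n -> 'cV[R]_n}).

Lemma to_column_surj x : exists v, to_column v = x.
Proof. exact: to_image_surj. Qed.

Lemma to_column_eq0 v : to_column v = 0 <-> B *m v = 0.
Proof. exact: to_image_eq0. Qed.

Lemma row_functional_subproof (w : 'cV[R]_n) :
  (fun x : column_module => (w^T *m image_val x) 0 0 : R^o) \in linear_pred (M := column_module).
Proof. by apply/asboolP => a x y; rewrite /= linearP !mxE. Qed.

Definition row_functional w : dual column_module := Dual (row_functional_subproof w).

Lemma row_functional_is_linear : linear row_functional.
Proof.
move=> a u v; apply: val_inj; apply: funext => x.
rewrite -[RHS]/(a * (u^T *m image_val x) 0 0 + (v^T *m image_val x) 0 0) /=.
by rewrite linearP mulmxDl -scalemxAl !mxE.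
Qed.

HB.instance Definition _ :=
  GRing.isLinear.Build R 'cV[R]_n (dual column_module) *:%R row_functional
    row_functional_is_linear.

Hypotheses (AB : exact_pair A B) (ABt : exact_pair A^T B^T).

(** Pulled back along [B], a functional becomes a row [u] with [A^T u = 0], because [B A = 0].
    Exactness of the transposes gives [u = B^T w], so the functional extends to the free module as
    [w]. *)
Lemma row_functional_surj g : exists w, row_functional w = g.
Proof.
have [u gu] := linear_cV_functional (g \o to_column : {linear 'cV[R]_n -> R^o}).
have Au : A^T *m u = 0.
  apply: trmx_inj; rewrite trmx_mul trmxK trmx0.
  apply: mulmx_cV_eq => v; rewrite mul0mx -mulmxA; apply/matrixP => a b.
  rewrite !ord1 -gu /= mxE (_ : to_column _ = 0) ?raddf0 //.
  by apply/to_column_eq0/(AB.2 _).2; exists v.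
have [w wu] := (ABt.1 u).1 Au; exists w; apply: val_inj; apply: funext => x.
have [v <-] := to_column_surj x; have := gu v; rewrite /= => ->.
by rewrite -wu trmx_mul trmxK mulmxA.
Qed.

(** Together with surjectivity this identifies the dual with the image of [B^T], so the dual is
    resolved by the transposed pair. *)
Lemma row_functional_eq0 w : row_functional w = 0 <-> B^T *m w = 0.
Proof.
split=> [w0|Bw].
  apply: trmx_inj; rewrite trmx_mul trmxK trmx0; apply: mulmx_cV_eq => v.
  rewrite mul0mx -mulmxA; apply/matrixP => a b; rewrite !ord1 [RHS]mxE.
  exact: (congr1 (fun g : dual column_module => g (to_column v)) w0).
apply: val_inj; apply: funext => x; have [v <-] := to_column_surj x.
by rewrite /= mulmxA -[B]trmxK -trmx_mul Bw trmx0 mul0mx mxE.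
Qed.

(** Coordinate functionals separate points. A functional on the dual is given by a column [v]; as it
    kills the rows [A^T u], which are zero on the module, [A v = 0] and [v = B y], so it is
    evaluation at the class of [y]. *)
Lemma biduality_bijective : bijective (@biduality R column_module).
Proof.
apply: (inj_surj_bijective (g := @biduality R column_module)) => [x y xy|Psi].
  apply: val_inj; apply/matrixP => i j; rewrite [j]ord1.
  have := congr1 (fun g : dual (dual column_module) =>
                    g (row_functional (delta_mx i 0))) xy.
  by rewrite /= trmx_delta -!rowE !mxE.
have [v Psiv] := linear_cV_functional (Psi \o row_functional : {linear 'cV[R]_n -> R^o}).
have Av : A *m v = 0.
  apply: trmx_inj; rewrite trmx_mul trmx0; apply: mulmx_cV_eq => u.
  rewrite mul0mx -mulmxA; apply/matrixP => a b.
  rewrite !ord1 -Psiv /= mxE (_ : row_functional _ = 0) ?raddf0 //.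
  by apply/row_functional_eq0/(ABt.2 _).2; exists u.
have [y yv] := (AB.1 v).1 Av.
exists (to_column y); apply: val_inj; apply: funext => g.
have [w <-] := row_functional_surj g; have := Psiv w; rewrite /= => ->.
by rewrite yv -[v in LHS]trmxK -trmx_mul mxE.
Qed.

Lemma gdim_zero_column_module : gdim_zero column_module.
Proof.
split; last 1 first.
- move=> i i_gt0; apply: (@ext_zero_periodic _ _ A^T B^T _ row_functional) => //.
  + by rewrite !trmxK.
  + exact: row_functional_surj.
  + by move=> w; rewrite row_functional_eq0; exact: ABt.2.
- exact: biduality_bijective.
- move=> i i_gt0; apply: (@ext_zero_periodic _ _ A B _ to_column) => //.
  + exact: to_column_surj.
  + by move=> w; rewrite to_column_eq0; exact: AB.2.
Qed.

End ColumnModule.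

Section Linear.
Variable R : comNzRingType.

Lemma linear_inverse (U W : lmodType R) (h : {linear U -> W}) :
  bijective h -> exists g : {linear W -> U}, cancel h g /\ cancel g h.
Proof.
case=> g hK gK.
have g_lin : linear g by move=> a u v; apply: (can_inj hK); rewrite linearP !gK.
pose gl : {linear W -> U} := HB.pack g (GRing.isLinear.Build R W U *:%R g g_lin).
by exists gl.
Qed.

Lemma generated_by_isomorphic (U W : lmodType R) n :
  isomorphic U W -> generated_by U n -> generated_by W n.
Proof.
move=> [h [h' hK h'K]] [g gP]; exists (h \o g) => w.
have [c wc] := gP (h' w); exists c; rewrite -[w]h'K wc linear_sum.
by apply: eq_bigr => i _; rewrite linearZ.
Qed.

Lemma isomorphic_sym (U W : lmodType R) : isomorphic U W -> isomorphic W U.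
Proof. by move=> [h /linear_inverse[g [hK gK]]]; exists g, h. Qed.

(** This separates members of the family with different [n]. *)
Lemma minimally_generated_inj (U W : lmodType R) m n :
  isomorphic U W -> minimally_generated_by U m -> minimally_generated_by W n -> m = n.
Proof.
move=> UW [Um min_m] [Wn min_n]; apply/eqP; rewrite eqn_leq min_m ?min_n //.
  exact: (generated_by_isomorphic UW).
exact: (generated_by_isomorphic (isomorphic_sym UW)).
Qed.

End Linear.

(** * The nilpotent shift and the idempotents commuting with it *)

Section Shift.
Variables (R : comNzRingType) (n : nat).

(** The nilpotent Jordan block with ones just below the diagonal. *)
Definition shift_mx : 'M[R]_n := \matrix_(i, j) (i == j.+1 :> nat)%:R.

Lemma shift_mx_trig : is_trig_mx shift_mx.
Proof.
by apply/is_trig_mxP => i j lt_ij; rewrite mxE ltn_eqF // ltnS ltnW.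
Qed.

Lemma shift_mx_diag i : shift_mx i i = 0.
Proof. by rewrite mxE ltn_eqF. Qed.

End Shift.

Arguments shift_mx {R} n.

Lemma map_shift_mx (R R' : comNzRingType) n (g : {rmorphism R -> R'}) :
  map_mx g (shift_mx n) = shift_mx n.
Proof. by apply/matrixP => i j; rewrite !mxE rmorph_nat. Qed.

Lemma shift_mxX (R : comNzRingType) n m (i j : 'I_n.+1) :
  (shift_mx n.+1 ^+ m) i j = (i == j + m :> nat)%N%:R :> R.
Proof.
elim: m i j => [|m IH] i j; first by rewrite expr0 mxE addn0.
rewrite exprSr -mulmxE mxE; under eq_bigr => l _ do rewrite IH mxE -natrM mulnb.
rewrite -natr_sum; congr (_%:R).
have [lt_jn|] := ltnP j n.
  rewrite (bigD1 (Ordinal (lt_jn : (j.+1 < n.+1)%N))) //= eqxx andbT addSnnS.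
  by rewrite big1 ?addn0 // => l; rewrite -val_eqE /= => /negPf->; rewrite andbF.
rewrite leq_eqVlt => /orP[/eqP nj|]; last by rewrite ltnNge -ltnS ltn_ord.
(* Last column: the index [j.+1] is out of range, so all terms vanish, and so does the right-hand
   side since [i <= n]. *)
rewrite big1 => [|l _]; first last.
  by case: (l =P j.+1 :> nat) => [l_eq|_]; rewrite ?andbF //;
     move: (ltn_ord l); rewrite l_eq -nj ltnn.
by rewrite -nj ltn_eqF // addnS ltnS (leq_trans _ (leq_addr m n)) // -ltnS.
Qed.

Lemma shift_mx_nilpotent (R : comNzRingType) n : shift_mx n.+1 ^+ n.+1 = 0 :> 'M[R]_n.+1.
Proof.
apply/matrixP => i j; rewrite shift_mxX mxE ltn_eqF //.
by rewrite (leq_trans (ltn_ord i)) // leq_addl.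
Qed.

Section Commutant.
Variables (k : fieldType) (n : nat).
Implicit Types P : 'M[k]_n.+1.
Let Nil : 'M[k]_n.+1 := shift_mx n.+1.
Let e : 'cV[k]_n.+1 := delta_mx ord_max 0.

(** Row [j + 1] of the product reads [v j = 0], so only the last coordinate survives. *)
Lemma shift_mx_ker (v : 'cV[k]_n.+1) : Nil *m v = 0 -> v = v ord_max 0 *: e.
Proof.
move=> Nv; apply/matrixP => j b; rewrite [b]ord1 !mxE eqxx andbT.
have [->|ne] := eqVneq j ord_max; first by rewrite mulr1.
have lt_jn : (j.+1 < n.+1)%N.
  by rewrite ltnS ltn_neqAle -ltnS ltn_ord andbT; move: ne; rewrite -val_eqE.
have /matrixP/(_ (Ordinal lt_jn) 0) := Nv; rewrite mxE (bigD1 j) //= mxE eqxx mul1r.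
rewrite big1 ?addr0 ?mulr0 => [->|l]; first by rewrite mxE.
by rewrite eq_sym -val_eqE /= => ne_l; rewrite mxE /= eqSS (negPf ne_l) mul0r.
Qed.

(* The kernel of the shift is a line, so it meets every nonzero invariant
   subspace. *)
Lemma commutant_fixes_ker P (v : 'cV[k]_n.+1) :
  P *m Nil = Nil *m P -> P *m v = v -> v != 0 -> P *m e = e.
Proof.
move=> PN Pv v0.
have ex_m : exists m, Nil ^+ m *m v == 0.
  by exists n.+1; rewrite shift_mx_nilpotent mul0mx.
(* The least exponent killing [v] is positive; the power just before it sends [v] to a nonzero
   vector of the kernel line, still fixed by [P]. *)
case: (ex_minnP ex_m) => -[|m] /eqP Nmv m_min.
  by rewrite expr0 mul1mx in Nmv; rewrite Nmv eqxx in v0.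
pose u := Nil ^+ m *m v.
have u0 : u != 0 by apply/negP => /m_min; rewrite ltnn.
have Pu : P *m u = u.
  have PNm : P * Nil ^+ m = Nil ^+ m * P by apply: commrX.
  by rewrite /u mulmxA [P *m _]PNm -[RHS]/(Nil ^+ m *m v) -mulmxA Pv.
have uE : u = u ord_max 0 *: e.
  by apply: shift_mx_ker; rewrite /u mulmxA -[Nil *m _]/(Nil * Nil ^+ m) -exprS.
have c0 : u ord_max 0 != 0 by apply: contra_neq u0 => c0; rewrite uE c0 scale0r.
apply: (scalerI c0); rewrite scalemxAr -uE Pu //.
Qed.

(** If [P] and [1 - P] are both nonzero, each fixes a nonzero vector of its image, hence fixes [e];
    but then [e = (1 - P) e = e - P e = 0]. *)
Lemma idempotent_commutantS P :
  P *m P = P -> P *m Nil = Nil *m P -> P = 0 \/ P = 1%:M.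
Proof.
move=> PP PN; have [->|P0] := eqVneq P 0; [by left|right].
apply/eqP/contraT => P1.
have pick_v (Q : 'M[k]_n.+1) : Q != 0 -> exists w : 'cV_n.+1, Q *m w != 0.
  move=> Q0; apply: contrapT => /forallNP h; move/eqP: Q0; apply.
  by apply: mulmx_cV_eq => w; rewrite mul0mx; apply/eqP/negPn/negP/h.
have Q0 : 1%:M - P != 0 by rewrite subr_eq0 eq_sym.
have [w Pw] := pick_v P P0; have [w' Qw'] := pick_v _ Q0.
have eP : P *m e = e.
  by apply: (commutant_fixes_ker PN _ Pw); rewrite mulmxA PP.
have eQ : (1%:M - P) *m e = e.
  apply: (commutant_fixes_ker _ _ Qw').
    by rewrite mulmxBl mulmxBr mul1mx mulmx1 PN.
  by rewrite mulmxA mulmxBl mul1mx mulmxBr mulmx1 PP subrr subr0.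
have /matrixP/(_ ord_max 0) : e = 0 by rewrite -eQ mulmxBl mul1mx eP subrr.
by rewrite !mxE !eqxx => /eqP; rewrite oner_eq0.
Qed.

End Commutant.

Lemma idempotent_commutant (k : fieldType) n (P : 'M[k]_n) :
  P *m P = P -> P *m shift_mx n = shift_mx n *m P -> P = 0 \/ P = 1%:M.
Proof.
case: n P => [|n] P; last exact: idempotent_commutantS.
by left; apply/matrixP => -[].
Qed.

(** * Homomorphisms between column modules *)

Section Lifting.
Variables (R : comNzRingType) (n n' : nat).
Variables (A B : 'M[R]_n) (A' B' : 'M[R]_n').
Hypotheses (AB : exact_pair A B) (AB' : exact_pair A' B').

Lemma factor_exact (m : nat) (X : 'M[R]_(n', m)) :
  (forall v : 'cV[R]_m, B' *m (X *m v) = 0) -> exists Y : 'M[R]_(n', m), X = A' *m Y.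
Proof.
move=> BX.
have col_X j : exists u : 'cV[R]_n', A' *m u = col j X.
  by apply/(AB'.2 _).1; rewrite colE.
have [u uP] := choice col_X; exists (\matrix_(i, j) u j i 0).
apply/matrixP => i j; have /matrixP/(_ i 0) := uP j; rewrite !mxE => <-.
by apply: eq_bigr => l _; rewrite mxE.
Qed.

(** Comparison of presentations: [P] exists by freeness, and [P A] lands in the kernel of [B'],
    which is the image of [A']; this gives [Q]. *)
Lemma lift_column_hom (h : {linear column_module B -> column_module B'}) :
  exists (P Q : 'M[R]_(n', n)),
    (forall v, h (to_column B v) = to_column B' (P *m v)) /\ P *m A = A' *m Q.
Proof.
have [p pP] := choice (fun j => to_column_surj (h (to_column B (delta_mx j 0)))).
pose P : 'M[R]_(n', n) := \matrix_(i, j) p j i 0.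
have hP v : h (to_column B v) = to_column B' (P *m v).
  apply: (linear_cV_ext (g := h \o to_column B : {linear 'cV[R]_n -> column_module B'})
                        (h := to_column B' \o mulmx P : {linear 'cV[R]_n -> column_module B'})).
  move=> j /=; rewrite -pP -colE; congr (to_column B' _).
  by apply/matrixP => a b; rewrite !mxE [b]ord1.
have [|Q PQ] := @factor_exact _ (P *m A); last by exists P, Q.
move=> v; apply/to_column_eq0; rewrite -mulmxA -hP -(raddf0 h); congr (h _).
by apply/to_column_eq0/(AB.2 _).2; exists v.
Qed.

End Lifting.

(** * Reduction of matrix identities to the residue field *)

Section MapProduct.
Variables (R k : comNzRingType) (eps : {rmorphism R -> k}) (D : {additive R -> k}).

(** On multiples of [l], [D] behaves like a linear form over the residue field. For such entries [D]
    turns a matrix product into one whose other factor is reduced by [eps]. *)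
Definition scales_on (l : R) : Prop := forall a, D (a * l) = eps a * D l.

Lemma map_mx_mull m n p (P : 'M[R]_(m, n)) (A : 'M[R]_(n, p)) :
  (forall i j, scales_on (A i j)) ->
  map_mx D (P *m A) = map_mx eps P *m map_mx D A.
Proof.
move=> DA; apply/matrixP => i j; rewrite !mxE raddf_sum.
by apply: eq_bigr => l _; rewrite !mxE DA.
Qed.

Lemma map_mx_mulr m n p (A : 'M[R]_(m, n)) (P : 'M[R]_(n, p)) :
  (forall i j, scales_on (A i j)) ->
  map_mx D (A *m P) = map_mx D A *m map_mx eps P.
Proof.
move=> DA; apply/matrixP => i j; rewrite !mxE raddf_sum.
by apply: eq_bigr => l _; rewrite !mxE mulrC DA mulrC.
Qed.

End MapProduct.

Section Minimality.
Variables (R : comNzRingType) (k : fieldType) (eps : {rmorphism R -> k}).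
Variables (n : nat) (A B : 'M[R]_n).
Hypotheses (AB : exact_pair A B) (A_eps : map_mx eps A = 0).

(** Nakayama in matrix form: [m] generators give [1 - V C = A Y]. The entries of [A] have zero
    residue, so [V C] reduces to the identity of rank [n], and [n <= m]. *)
Lemma column_module_min_gen : minimally_generated_by (column_module B) n.
Proof.
split.
  exists (fun i => to_column B (delta_mx i 0)) => x; have [v <-] := to_column_surj x.
  exists (fun i => v i 0); rewrite {1}[v]delta_expansion linear_sum.
  by apply: eq_bigr => i _; rewrite linearZ.
move=> m [g gP].
have [v vP] := choice (fun j => to_column_surj (g j)).
have [c cP] := choice (fun i => gP (to_column B (delta_mx i 0))).
pose V : 'M[R]_(n, m) := \matrix_(i, j) v j i 0.
pose C : 'M[R]_(m, n) := \matrix_(i, j) c j i.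
have [|Y YP] := factor_exact AB (X := 1%:M - V *m C).
  move=> w; apply/to_column_eq0; move: w.
  pose zero : {linear 'cV[R]_n -> column_module B} := \0.
  apply: (linear_cV_ext (g := to_column B \o mulmx (1%:M - V *m C)
                              : {linear 'cV[R]_n -> column_module B}) (h := zero)).
  move=> i; rewrite /= mulmxBl mul1mx raddfB /=; apply/eqP; rewrite subr_eq0 cP.
  rewrite -mulmxA -colE (_ : V *m col i C = \sum_j c i j *: v j).
    by rewrite linear_sum; apply/eqP/eq_bigr => j _; rewrite linearZ vP.
  apply/matrixP => a b; rewrite [b]ord1 mxE summxE; apply: eq_bigr => j _.
  by rewrite !mxE mulrC.
have /(congr1 (map_mx eps)) := YP.
rewrite map_mxM A_eps mul0mx map_mxB map_mx1 map_mxM /= => /eqP.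
rewrite subr_eq0 => /eqP VC1; rewrite -[n](mxrank1 k) VC1.
exact: leq_trans (mxrankM_maxl _ _) (rank_leq_col _).
Qed.

Hypothesis m3 : forall a b c, eps a = 0 -> eps b = 0 -> eps c = 0 -> a * b * c = 0.

(** An idempotent equals its cube, which is represented by [P ^ 3], a matrix with entries in the
    cube of the maximal ideal. *)
Lemma idempotent_nilpotent (q : column_module B -> column_module B) (P : 'M[R]_n) :
  (forall v, q (to_column B v) = to_column B (P *m v)) ->
  (forall x, q (q x) = q x) -> map_mx eps P = 0 -> forall x, q x = 0.
Proof.
move=> qP qq P0 x; rewrite -qq -qq; have [v <-] := to_column_surj x.
rewrite !qP !mulmxA (_ : P *m P *m P = 0) ?mul0mx ?raddf0 //.
have eP i j : eps (P i j) = 0 by have /matrixP/(_ i j) := P0; rewrite !mxE.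
apply/matrixP => i j; rewrite !mxE big1 // => l _; rewrite mxE mulr_suml big1 // => l' _.
exact: m3.
Qed.

Variables (D1 D2 : {additive R -> k}).
Hypotheses (D1A : forall i j, scales_on eps D1 (A i j))
           (D2A : forall i j, scales_on eps D2 (A i j)).
Hypotheses (D1_A : map_mx D1 A = 1%:M) (D2_A : map_mx D2 A = shift_mx n) (n_gt0 : (0 < n)%N).

(** A decomposition gives an idempotent endomorphism [q]. The residue of its lift is an idempotent
    commuting with the shift, hence 0 or 1, and then [q] or [1 - q] vanishes. *)
Lemma column_module_indecomposable : indecomposable (column_module B).
Proof.
split.
  apply: contrapT => /forallNP M0; have := column_module_min_gen.2 0%N.
  rewrite leqn0 -[n == _]negbK -lt0n n_gt0 => h; suff: false by [].
  apply: h; exists (fun i => to_column B 0) => x; exists (fun=> 0).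
  by rewrite big_ord0; apply: contrapT => /M0.
move=> X Y [h /linear_inverse[g [hK gK]]].
have q_lin : linear (fun x => g ((h x).1, 0)).
  move=> a x y; rewrite -(linearP g) (linearP h); congr (g _).
  by rewrite -[RHS]/(a *: (h x).1 + (h y).1, a *: 0 + 0) scaler0 addr0.
have [q qE] : exists q : {linear column_module B -> column_module B},
    forall x, q x = g ((h x).1, 0).
  pose q : {linear column_module B -> column_module B} :=
    HB.pack (fun x => g ((h x).1, 0))
      (GRing.isLinear.Build R (column_module B) (column_module B) *:%R _ q_lin).
  by exists q.
have qq x : q (q x) = q x by rewrite !qE gK.
have [P [Q [qP PQ]]] := lift_column_hom AB AB q.
have PP : map_mx eps P *m map_mx eps P = map_mx eps P.
  have [|Z PZ] := factor_exact AB (X := P *m P - P).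
    move=> v; apply/to_column_eq0; rewrite mulmxBl raddfB /= -mulmxA -!qP qq.
    by rewrite subrr.
  apply/eqP; rewrite -map_mxM -subr_eq0 -map_mxB PZ map_mxM A_eps mul0mx //.
(* [D1] sees only the identity part of [A], and yields equal residues for [P] and [Q]; [D2] sees
   only the shift, and yields commutation. *)
have PQ0 : map_mx eps P = map_mx eps Q.
  have := congr1 (map_mx D1) PQ; rewrite (map_mx_mull P D1A) (map_mx_mulr Q D1A).
  by rewrite D1_A mulmx1 mul1mx.
have PN : map_mx eps P *m shift_mx n = shift_mx n *m map_mx eps P.
  have := congr1 (map_mx D2) PQ; rewrite (map_mx_mull P D2A) (map_mx_mulr Q D2A).
  by rewrite D2_A -PQ0.
case: (idempotent_commutant PP PN) => [P0|P1]; [left => a|right => b].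
  have := idempotent_nilpotent qP qq P0 (g (a, 0)).
  by rewrite qE gK /= -(raddf0 g) => /(can_inj gK)[].
have q'P v : to_column B v - q (to_column B v) = to_column B ((1%:M - P) *m v).
  by rewrite qP mulmxBl mul1mx raddfB.
have q'q' x : x - q x - q (x - q x) = x - q x.
  by rewrite linearB qq subrr subr0.
have P'0 : map_mx eps (1%:M - P) = 0 by rewrite map_mxB map_mx1 P1 subrr.
have := idempotent_nilpotent q'P q'q' P'0 (g (0, b)).
by rewrite qE gK => /eqP; rewrite subr_eq0 => /eqP/(can_inj gK)[].
Qed.

End Minimality.

(** [D] turns [P A = A' Q] into [P0 (1 + c N) = c' N Q0] over [k]. The right side is singular and
    [1 + c N] is unipotent, so [P0] is singular, whereas the inverse isomorphism makes it
    invertible. *)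
Lemma column_module_not_isomorphic (R : comNzRingType) (k : fieldType)
  (eps : {rmorphism R -> k}) (D : {additive R -> k}) n (A B A' B' : 'M[R]_n) c c' :
  (0 < n)%N -> exact_pair A B -> exact_pair A' B' -> map_mx eps A = 0 ->
  (forall i j, scales_on eps D (A i j)) -> (forall i j, scales_on eps D (A' i j)) ->
  map_mx D A = 1%:M + c *: shift_mx n -> map_mx D A' = c' *: shift_mx n ->
  ~ isomorphic (column_module B) (column_module B').
Proof.
move=> n_gt0 AB AB' A_eps DA DA' D_A D_A' [h /linear_inverse[g [hK gK]]].
have [P [Q [hP PQ]]] := lift_column_hom AB AB' h.
have [P' [_ [gP' _]]] := lift_column_hom AB' AB g.
have P'P : map_mx eps P' *m map_mx eps P = 1%:M.
  have [|Z PZ] := factor_exact AB (X := P' *m P - 1%:M).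
    move=> v; apply/to_column_eq0; rewrite mulmxBl mul1mx raddfB /= -mulmxA -gP' -hP.
    by rewrite hK subrr.
  apply/eqP; rewrite -map_mxM -subr_eq0 -(map_mx1 eps) -map_mxB PZ map_mxM A_eps mul0mx //.
have := congr1 (map_mx D) PQ; rewrite (map_mx_mull P DA) (map_mx_mulr Q DA') D_A D_A'.
move/(congr1 determinant)/eqP; rewrite !det_mulmx detZ.
have -> : \det (shift_mx n : 'M[k]_n) = 0.
  rewrite det_trig ?shift_mx_trig //; apply/eqP; rewrite prodf_seq_eq0.
  by apply/hasP; exists (Ordinal n_gt0); rewrite ?mem_index_enum //= shift_mx_diag.
have -> : \det (1%:M + c *: shift_mx n) = 1.
  rewrite det_trig.
    by rewrite big1 // => i _; rewrite mxE mxE eqxx mxE shift_mx_diag mulr0 addr0.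
  apply/is_trig_mxP => i j lt_ij; rewrite mxE mxE [X in _ + X]mxE.
  by rewrite (is_trig_mxP (shift_mx_trig k n)) // -val_eqE ltn_eqF // mulr0 addr0.
rewrite mulr0 mul0r mulr1 => /eqP P0; have /(congr1 determinant)/eqP := P'P.
by rewrite det_mulmx P0 mulr0 det1 eq_sym oner_eq0.
Qed.

(** * Matrix factorizations *)

Section MatrixFactorization.
Variables (S R : comNzRingType) (phi : {rmorphism S -> R}) (f : S).
Hypotheses (f_reg : GRing.lreg f) (phi_surj : forall y, exists x, phi x = y).
Hypothesis (phi_ker : forall s, phi s = 0 <-> exists t, s = t * f).

(** Lift [v] to [v'] over [S] and write [A v' = f w']. Multiplying by [B] gives [f v' = f B w'],
    where [f] cancels. *)
Let half_exact n (A B : 'M[S]_n) : A *m B = f%:M -> B *m A = f%:M ->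
  forall v : 'cV[R]_n,
    map_mx phi A *m v = 0 <-> exists u : 'cV[R]_n, map_mx phi B *m u = v.
Proof.
move=> AB BA v; split=> [Av|[u <-]]; last first.
  rewrite mulmxA -map_mxM AB map_scalar_mx /= (phi_ker f).2 ?mul_scalar_mx ?scale0r //.
  by exists 1; rewrite mul1r.
have [g gP] := choice phi_surj.
pose v' : 'cV[S]_n := map_mx g v.
have v'E : map_mx phi v' = v by apply/matrixP => i j; rewrite !mxE gP.
have Aw i : exists t, (A *m v') i 0 = t * f.
  apply/phi_ker; have /matrixP/(_ i 0) := Av.
  by rewrite -v'E -map_mxM !mxE.
have [w wP] := choice Aw; pose w' : 'cV[S]_n := \col_i w i.
have Avw : A *m v' = f%:M *m w'.
  by apply/matrixP => i j; rewrite [j]ord1 wP mul_scalar_mx !mxE mulrC.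
exists (map_mx phi w'); rewrite -v'E -map_mxM; congr (map_mx phi _).
have /matrixP h : f *: v' = f *: (B *m w').
  by rewrite -!mul_scalar_mx -{1}BA -mulmxA Avw mulmxA (scalar_mxC f B) -mulmxA.
by apply/matrixP => i j; have := h i j; rewrite mxE [(_ *: (B *m w')) i j]mxE => /f_reg->.
Qed.

Lemma matrix_factorization_exact n (A B : 'M[S]_n) :
  A *m B = f%:M -> B *m A = f%:M -> exact_pair (map_mx phi A) (map_mx phi B).
Proof. by move=> AB BA; split; exact: half_exact. Qed.

Lemma matrix_factorization_exact_tr n (A B : 'M[S]_n) :
  A *m B = f%:M -> B *m A = f%:M -> exact_pair (map_mx phi A)^T (map_mx phi B)^T.
Proof.
move=> AB BA; rewrite !map_trmx; apply: matrix_factorization_exact.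
  by rewrite -trmx_mul BA tr_scalar_mx.
by rewrite -trmx_mul AB tr_scalar_mx.
Qed.

End MatrixFactorization.

Definition jordan_mx (S : comNzRingType) (x z : S) n : 'M[S]_n :=
  x%:M + z *: shift_mx n.

(** In the application [y i] is the quotient of [f (- z)^i] by [x^(i+1)]. *)
Definition jordan_cofactor (S : comNzRingType) (y : nat -> S) n : 'M[S]_n.+1 :=
  \sum_(i < n.+1) y i *: shift_mx n.+1 ^+ i.

(* [jordan_cofactor y n] is [f] times the Neumann series of the inverse of
   [x + z N], where [N] is the nilpotent shift. *)
Lemma jordan_factorization (S : comNzRingType) (x z f : S) (y : nat -> S) n :
  x * y 0%N = f -> (forall i, x * y i.+1 = - (z * y i)) ->
  jordan_mx x z n.+1 *m jordan_cofactor y n = f%:M /\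
  jordan_cofactor y n *m jordan_mx x z n.+1 = f%:M.
Proof.
move=> xy0 xyS; pose Nil : 'M[S]_n.+1 := shift_mx n.+1.
have AE : jordan_mx x z n.+1 = x *: 1 + z *: Nil.
  by rewrite /jordan_mx -scalemx1.
(* The product telescopes; at [m = n] the remaining term contains a vanishing power of the shift. *)
have partial m : jordan_mx x z n.+1 * (\sum_(i < m.+1) y i *: Nil ^+ i) =
    f%:M + (z * y m) *: Nil ^+ m.+1.
  elim: m => [|m IH].
    rewrite big_ord1 expr0 AE mulrDl -!scalerAl -!scalerAr !mul1r !mulr1 !scalerA xy0.
    by rewrite expr1 -scalemx1.
  rewrite big_ord_recr mulrDr IH /= AE mulrDl -!scalerAl -!scalerAr mul1r !scalerA.
  by rewrite xyS scaleNr -exprS addrA addrK.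
have AB : jordan_mx x z n.+1 *m jordan_cofactor y n = f%:M.
  by rewrite [LHS]partial shift_mx_nilpotent scaler0 addr0.
(* Both factors are polynomials in the shift, so they commute. *)
split=> //; rewrite -AB -[LHS]/(_ * _) -[RHS]/(_ * _) mulr_suml mulr_sumr.
apply: eq_bigr => i _; rewrite AE mulrDl mulrDr -!scalerAl -!scalerAr mul1r mulr1.
by rewrite -exprS -exprSr !scalerA [x * _]mulrC [z * _]mulrC.
Qed.

(** * Self-injectivity of the dual numbers *)

Section SubspaceComplement.
Variables (k : fieldType) (R : comAlgType k) (U : lmodType R).

Definition subspace (W : set U) : Prop :=
  W 0 /\ forall (c : k) x y, W x -> W y -> W (c%:A *: x + y).

(** Zorn's lemma, as [U] is arbitrary: a set maximal among those closed under combinations and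
    meeting [W] at most in 0 is a complement. *)
Lemma subspace_complement (W : set U) : subspace W ->
  exists C : set U, [/\ subspace C, (forall u, W u -> C u -> u = 0) &
    forall u, exists w c, [/\ W w, C c & u = w + c]].
Proof.
move=> [W0 WD].
(* Containing 0 is not part of [P], so that the union of the empty chain qualifies; a maximal set
   contains 0 all the same. *)
pose P (C : set U) := (forall (c : k) x y, C x -> C y -> C (c%:A *: x + y)) /\
  forall u, W u -> C u -> u = 0.
have [F FP F_tot|C [[CD CW] C_max]] := @Zorn_bigcup U P.
  split=> [c x y [X FX Xx] [Y FY Yy]|u Wu [X FX Xu]]; last exact: (FP X FX).2.
  have [XY|YX] := F_tot X Y FX FY.
    by exists Y => //; apply: (FP Y FY).1 => //; apply: XY.
  by exists X => //; apply: (FP X FX).1 => //; apply: YX.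
have C0 : C 0.
  apply: contrapT => nC0; apply: (C_max [set 0]).
    split=> [x Cx|]; last by move=> /(_ 0 erefl).
    by exfalso; apply: nC0; rewrite -(addNr x) -scaleN1r -[-1](scaleN1r 1); apply: CD.
  by split=> [c x y -> ->|u _ -> //]; rewrite /= scaler0 addr0.
exists C; split=> // u; apply: contrapT => no_dec.
(* Adjoining a vector [u] outside [W + C] keeps the intersection with [W] trivial, against
   maximality. *)
apply: (C_max [set x | exists t c, C c /\ x = t%:A *: u + c]).
  split=> [x Cx|sub]; first by exists 0, x; split=> //; rewrite !scale0r add0r.
  have Cu : C u by apply: sub; exists 1, 0; rewrite scale1r scale1r addr0.
  by apply: no_dec; exists 0, u; rewrite add0r.
split=> [a _ _ [t [c [Cc ->]]] [t' [c' [Cc' ->]]]|x Wx [t [c [Cc xE]]]].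
  exists (a * t + t'), (a%:A *: c + c'); split; first exact: CD.
  by rewrite !scalerDl scalerDr !scalerA mulr_algl scalerA addrACA.
have [t0|t0] := eqVneq t 0.
  by move: xE Wx; rewrite t0 !scale0r add0r => -> /CW; apply.
case: no_dec; exists (t^-1%:A *: x), ((- t^-1)%:A *: c); split.
- by rewrite -[_ *: x]addr0; apply: WD.
- by rewrite -[_ *: c]addr0; apply: CD.
rewrite xE scalerDr scalerA mulr_algl scalerA mulVf // scale1r scale1r.
by rewrite !scaleNr addrK.
Qed.

End SubspaceComplement.

(* [R = k + k v] with [v ^ 2 = 0] is self-dual through the coefficient of [v], so
   that a map to [R] is the same as a [k]-linear form. *)
Lemma gorenstein_dual_numbers (k : fieldType) (R : comAlgType k) (v : R)
  (re im : R -> k) :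
  (forall a, a = (re a)%:A + im a *: v) -> v * v = 0 ->
  (forall c d, c%:A + d *: v = 0 -> c = 0 /\ d = 0) -> gorenstein R.
Proof.
move=> dec vv free; exists 0%N; left=> A B j g j_inj.
have uniq c d a : a = c%:A + d *: v -> re a = c /\ im a = d.
  move=> aE; have /(free _ _) [] : (re a - c)%:A + (im a - d) *: v = 0.
    by rewrite !scalerBl addrACA -opprD -dec aE subrr.
  by move=> /eqP; rewrite subr_eq0 => /eqP-> /eqP; rewrite subr_eq0 => /eqP->.
have imP c a b : im (c *: a + b) = c * im a + im b.
  apply: (uniq (c * re a + re b) _ _ _).2.
  rewrite {1}[a]dec {1}[b]dec scalerDr !scalerA !scalerDl -!addrA.
  by congr (_ + _); rewrite addrCA.
have va a : v * a = re a *: v.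
  by rewrite {1}[a]dec mulrDr -scalerAr mulr1 -scalerAr vv scaler0 addr0.
have imv a : im (v * a) = re a.
  by apply: (uniq 0 _ _ _).2; rewrite va scale0r add0r.
have jA_sub : subspace (range j).
  split=> [|c _ _ [x _ <-] [y _ <-]]; first by exists 0; rewrite ?raddf0.
  by exists (c%:A *: x + y) => //; rewrite linearP.
have [C [[C0 CD] jAC dec_B]] := subspace_complement jA_sub.
have dec_B' b : exists a, C (b - j a).
  have [_ [c [[a _ <-] Cc ->]]] := dec_B b.
  by exists a; rewrite addrC addKr.
have [p pP] := choice dec_B'.
(* [G] is the [k]-linear form on [B] that extends [im] composed with [g] and vanishes on the
   complement [C]. *)
pose G b := im (g (p b)).
have GP a b : C (b - j a) -> G b = im (g a).
  move=> Cba; rewrite /G; congr (im (g _)); apply: j_inj; apply/eqP.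
  rewrite -subr_eq0 -raddfB /=; apply/eqP/jAC; first by exists (p b - a).
  have := CD (-1) _ _ (pP b) Cba; rewrite scaleN1r scaleN1r opprB raddfB /=.
  by rewrite addrA subrK.
have Gj a : G (j a) = im (g a) by apply: GP; rewrite subrr.
have GD c b b' : G (c%:A *: b + b') = c * G b + G b'.
  have -> : c * G b + G b' = im (g (c%:A *: p b + p b')).
    by rewrite linearP -[c%:A *: _]/(c%:A * _) mulr_algl imP.
  by apply: GP; rewrite linearP opprD addrACA -scalerBr; exact: CD.
have GDl b b' : G (b + b') = G b + G b'.
  by have := GD 1 b b'; rewrite scale1r scale1r mul1r.
(* The [R]-linear map whose [im] part is [G]: its [re] part must be [G (v *: b)], since
   [im (v * a) = re a]. *)
pose h b : R^o := G b *: v + (G (v *: b))%:A.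
have h_lin : linear h.
  move=> r b b'.
  have G0 : G 0 = 0.
    by rewrite -(raddf0 j) Gj raddf0; apply: (uniq 0 _ _ _).2; rewrite !scale0r addr0.
  have GZ c x : G (c%:A *: x) = c * G x by have := GD c x 0; rewrite G0 !addr0.
  have Gr : G (r *: b) = re r * G b + im r * G (v *: b).
    by rewrite {1}[r]dec scalerDl GDl GZ -mulr_algl -scalerA GZ.
  have Gvr : G (v *: (r *: b)) = re r * G (v *: b).
    by rewrite scalerA va -mulr_algl -scalerA GZ.
  rewrite /h scalerDr !GDl Gr Gvr -[r *: _]/(r * _).
  rewrite mulrDr -scalerAr [r * v]mulrC va -scalerAr mulr1.
  have -> : G (v *: b) *: r = G (v *: b) *: ((re r)%:A + im r *: v) by rewrite -dec.
  rewrite !scalerDl !scalerDr !scalerA.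
  rewrite [re r * _]mulrC [re r * _]mulrC [im r * _]mulrC -!addrA; congr (_ + _).
  by rewrite [RHS]addrCA; congr (_ + _); rewrite addrCA.
pose hl : {linear B -> R^o} := HB.pack h (GRing.isLinear.Build R B R^o *:%R h h_lin).
exists hl => x; rewrite -[LHS]/(h (j x)) /h -linearZ !Gj linearZ /= imv.
by rewrite addrC -dec.
Qed.

(** * Bases *)

Section Bases.
Variables (k : fieldType) (R : comAlgType k).

Lemma lin_combE m (b : 'I_m -> R^o) c : lin_comb b c = \sum_i c i *: (b i : R).
Proof. by apply: eq_bigr => i _; rewrite -[LHS]/(_ * _) mulr_algl. Qed.

Lemma lin_combP (U : lmodType R) m (b : 'I_m -> U) (a : k) c d :
  lin_comb b (fun i => a * c i + d i) = a%:A *: lin_comb b c + lin_comb b d.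
Proof.
rewrite /lin_comb scaler_sumr -big_split; apply: eq_bigr => i _ /=.
by rewrite !scalerDl [a%:A *: _]scalerA mulr_algl scalerA.
Qed.

(** A spanning family of least length is free, since a nontrivial relation would allow one vector to
    be dropped. *)
Lemma basis_of_spanning (U : lmodType R) (W : set U) m (b : 'I_m -> U) :
  W = range (lin_comb b) -> exists m' (b' : 'I_m' -> U), is_basis W b'.
Proof.
move=> Wb; pose spans n := `[< exists b : 'I_n -> U, W = range (lin_comb b) >].
have : exists n, spans n by exists m; apply/asboolP; exists b.
case/ex_minnP => n /asboolP[{Wb m} b Wb] n_min; exists n, b; split=> // c c0 i.
apply: contrapT => /eqP ci0; case: n i b c Wb n_min c0 ci0 => [[]//|n] i b c Wb n_min c0 ci0.
suff : spans n by move/n_min; rewrite ltnn.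
apply/asboolP; exists (fun j => b (lift i j)); rewrite Wb; apply/seteqP; split.
  (* Subtracting the multiple [d i / c i] of the relation makes the coefficient at [i] vanish. *)
  move=> _ [d _ <-]; pose d' j := - (d i / c i) * c j + d j.
  exists (fun j => d' (lift i j)) => //.
  have : lin_comb b d' = lin_comb b d by rewrite lin_combP c0 scaler0 add0r.
  move=> <-; rewrite /lin_comb [RHS](bigD1_ord i) //= /d' mulNr divfK // addNr.
  by rewrite scale0r scale0r add0r.
move=> _ [d _ <-]; exists (fun j => oapp d 0 (unlift i j)) => //.
rewrite /lin_comb (bigD1_ord i) //= unlift_none /= scale0r scale0r add0r.
by apply: eq_bigr => j _; rewrite liftK.
Qed.

Lemma basis_mem (U : lmodType R) (W : set U) m (b : 'I_m -> U) i : is_basis W b -> W (b i).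
Proof.
move=> [-> _]; exists (fun j => (j == i)%:R) => //.
rewrite /lin_comb (bigD1 i) //= eqxx scale1r scale1r big1 ?addr0 // => j /negPf->.
by rewrite scale0r scale0r.
Qed.

Lemma basis_neq0 (U : lmodType R) (W : set U) m (b : 'I_m -> U) i : is_basis W b -> b i <> 0.
Proof.
move=> [_ free] bi0.
have c0 : lin_comb b (fun j => (j == i)%:R) = 0.
  rewrite /lin_comb big1 // => j _.
  by case: eqP => [->|_]; rewrite ?bi0 ?scaler0 // scale0r scale0r.
by have /eqP := free _ c0 i; rewrite eqxx oner_eq0.
Qed.

End Bases.

Section Quadrics.
Variables (k : fieldType) (N : nat) (A : comAlgType k).
Variable pi : {lrmorphism {mpoly k[N]} -> A}.
Hypothesis pi_graded : homogeneous_graded_ring pi.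

Lemma piece_X i : graded_piece pi 1 (pi 'X_i).
Proof. by exists 'X_i => //=; rewrite dhomogX; apply/eqP; exact: mdeg1. Qed.

(** Splitting off two variables leaves coefficients of degree zero, which are scalars; the products
    of two variables, indexed by pairs, therefore span. *)
Lemma piece2_spanning :
  exists m (b : 'I_m -> A^o), graded_piece pi 2 = range (lin_comb b).
Proof.
pose T : finType := ('I_N * 'I_N)%type.
exists #|T|, (fun t => pi 'X_(enum_val t).1 * pi 'X_(enum_val t).2).
have combE (c : 'I_#|T| -> k) :
    lin_comb (fun t => pi 'X_(enum_val t).1 * pi 'X_(enum_val t).2 : A^o) c =
    \sum_i \sum_j c (enum_rank (i, j)) *: (pi 'X_i * pi 'X_j).
  rewrite lin_combE pair_big /= (reindex (@enum_rank T)) /=; last exact/onW_bij/enum_rank_bij.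
  by apply: eq_bigr => -[i j] _; rewrite enum_rankK.
apply/seteqP; split=> [a|_ [c _ <-]]; last first.
  rewrite combE; apply: (piece_sum pi_graded) => i _; apply: (piece_sum pi_graded) => j _.
  by apply: (pieceZ pi_graded); apply: (pieceM (d := 1) (e := 1)); apply: piece_X.
move=> /(pieceS pi_graded)[q [q1 ->]].
have [q' q'P] := choice (fun i => pieceS pi_graded (q1 i)).
exists (fun t => augmentation pi (q' (enum_val t).1 (enum_val t).2)) => //.
rewrite combE; apply: eq_bigr => i _; have [q'0 ->] := q'P i.
rewrite mulr_sumr; apply: eq_bigr => j _; rewrite enum_rankK /=.
by rewrite [in RHS](piece0P pi_graded (q'0 j)) mulrA -[RHS]scalerAr mulr1.
Qed.

End Quadrics.

(** * Linear parameters *)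

Section LinearReduction.
Variables (k : fieldType) (N : nat) (S : comAlgType k).
Variable pi : {lrmorphism {mpoly k[N]} -> S}.
Hypothesis S_graded : homogeneous_graded_ring pi.

(** The condition [x S_1 = S_2] that will define the open set. *)
Definition multiplier (x : S) : Prop := graded_piece pi 1 x /\
  forall h, graded_piece pi 2 h -> exists w, graded_piece pi 1 w /\ h = x * w.

Lemma krull_dim_inj d e : krull_dim S d -> krull_dim S e -> d = e.
Proof.
by move=> [cd max_d] [ce max_e]; apply/eqP; rewrite eqn_leq max_e // max_d.
Qed.

(** In dimension one the system of parameters is a single [x], perhaps not homogeneous, and [S_2]
    lies in [n^2 = x n]. In the degree-two part of [x w'] only the linear parts of both factors
    contribute. *)
Lemma linear_parameter :
  krull_dim S 1 -> minimal_multiplicity pi -> exists x, multiplier x.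
Proof.
move=> S_dim1 [d [t [[S_dim t_max _] mul_t]]].
have d1 := krull_dim_inj S_dim S_dim1; move: d1 t t_max mul_t {S_dim} => -> t t_max mul_t.
pose x := tnth t ord0.
have tx y : y \in (t : seq S) -> y = x by case/tnthP => i ->; rewrite [i]ord1.
have x0 : augmentation pi x = 0 by apply/(graded_max_idealP S_graded)/t_max/mem_tnth.
exists (hcomp pi 1 x); split=> [|h h2]; first exact: hcompP.
have : ideal_mul (graded_max_ideal pi) (graded_max_ideal pi) h.
  have [q [q1 hE]] := pieceS S_graded h2.
  exists N, (fun=> 1), (fun i => pi 'X_i * q i); split=> [i|]; last first.
    by rewrite hE; apply: eq_bigr => i _; rewrite mul1r.
  exists (pi 'X_i); first exact/(graded_max_idealP S_graded)/(augmentation_piece S_graded)/piece_X.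
  by exists (q i) => //; apply/(graded_max_idealP S_graded)/(augmentation_piece S_graded)/q1.
rewrite -mul_t => -[m [a [b [bP hE]]]].
have xb i : exists w, augmentation pi w = 0 /\ b i = x * w.
  have [u [m' [c [e [eP ->]]]] [v /(graded_max_idealP S_graded) v0 <-]] := bP i.
  exists ((\sum_j c j) * v); split; first by rewrite (augmentation_monoid S_graded).2 v0 mulr0.
  rewrite mulrA; congr (_ * v); rewrite mulr_sumr; apply: eq_bigr => j _.
  by have ej : e j \in (t : seq S) := eP j; rewrite (tx _ ej) mulrC.
have [w wP] := choice xb; pose w' := \sum_i a i * w i.
have w'0 : augmentation pi w' = 0.
  rewrite -[LHS]/(augmentation_rmorphism S_graded w') rmorph_sum big1 // => i _.
  by rewrite rmorphM /= (wP i).1 mulr0.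
have hxw : h = x * w'.
  by rewrite hE mulr_sumr; apply: eq_bigr => i _; rewrite (wP i).2 mulrCA.
exists (hcomp pi 1 w'); split; first exact: hcompP.
rewrite -((pieceP S_graded 2 h).1 h2) hxw hcomp_mul // !big_ord_recl big_ord0 /=.
by rewrite !hcomp0 // x0 w'0 scale0r mul0r mulr0 add0r !addr0.
Qed.

End LinearReduction.

Section LinearBasis.
Variables (k : fieldType) (N : nat) (S : comAlgType k).
Variable pi : {lrmorphism {mpoly k[N]} -> S}.
Hypothesis S_graded : homogeneous_graded_ring pi.
Variables (e : nat) (beta : 'I_e -> S).

Definition comb (u : 'rV[k]_e) : S := \sum_i u 0 i *: beta i.

Lemma comb_is_linear : linear comb.
Proof.
move=> a u v; rewrite /comb scaler_sumr -big_split; apply: eq_bigr => i _ /=.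
by rewrite !mxE scalerDl scalerA.
Qed.

HB.instance Definition _ := GRing.isLinear.Build k 'rV[k]_e S *:%R comb comb_is_linear.

Definition linear_basis : Prop :=
  [/\ forall i, graded_piece pi 1 (beta i),
      forall s, graded_piece pi 1 s -> exists u, s = comb u &
      forall u, comb u = 0 -> u = 0].

Hypothesis beta_basis : linear_basis.

Lemma comb_piece u : graded_piece pi 1 (comb u).
Proof.
by have [b1 _ _] := beta_basis; apply: (piece_sum S_graded) => i _; apply: (pieceZ S_graded).
Qed.

Lemma comb_inj : injective comb.
Proof.
have [_ _ free] := beta_basis; move=> u v uv; apply/eqP; rewrite -subr_eq0.
by apply/eqP/free; rewrite raddfB /= uv subrr.
Qed.

Variable x : S.
Hypotheses (x_mult : multiplier pi x) (x_reg : GRing.lreg x).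

(** [T j] is the matrix of multiplication by [beta j] from [S_1] to [S_2 = x S_1], followed by
    division by [x]. *)
Lemma structure_matrices :
  exists T : 'I_e -> 'M[k]_e, forall j u, beta j * comb u = x * comb (u *m T j).
Proof.
have [b1 span _] := beta_basis.
have prod_ex (ji : 'I_e * 'I_e) : exists u : 'rV[k]_e, beta ji.1 * beta ji.2 = x * comb u.
  have [w [w1 ->]] := x_mult.2 _ (pieceM (b1 ji.1) (b1 ji.2)).
  by have [u ->] := span w w1; exists u.
have [t tP] := choice prod_ex.
exists (fun j => \matrix_i t (j, i)) => j u.
have -> : u *m (\matrix_i t (j, i)) = \sum_i u 0 i *: t (j, i).
  by rewrite mulmx_sum_row; apply: eq_bigr => i _; rewrite rowK.
rewrite linear_sum /= !mulr_sumr; apply: eq_bigr => i _.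
by rewrite linearZ /= -!scalerAr -tP.
Qed.

Variable T : 'I_e -> 'M[k]_e.
Hypothesis T_mul : forall j u, beta j * comb u = x * comb (u *m T j).

Definition mult_mx (c : 'rV[k]_e) : 'M[k]_e := \sum_j c 0 j *: T j.

Lemma mult_mxP c u : comb c * comb u = x * comb (u *m mult_mx c).
Proof.
rewrite /mult_mx mulmx_sumr linear_sum {1}/comb mulr_suml mulr_sumr.
by apply: eq_bigr => j _; rewrite -scalemxAr linearZ /= -scalerAl -scalerAr T_mul.
Qed.

(** An injective endomorphism of a finite-dimensional space is invertible. With [unit_multiplier]
    this turns regularity of a linear form into the nonvanishing of a determinant. *)
Lemma lreg_unit c : GRing.lreg (comb c) -> mult_mx c \in unitmx.
Proof.
move=> c_reg; rewrite -row_free_unit; apply: inj_row_free => u uc.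
apply: comb_inj; apply: c_reg.
by rewrite mult_mxP uc raddf0 !mulr0.
Qed.

Lemma unit_multiplier c : mult_mx c \in unitmx -> multiplier pi (comb c).
Proof.
move=> c_unit; split=> [|h h2]; first exact: comb_piece.
have [w [w1 ->]] := x_mult.2 h h2; have [_ span _] := beta_basis.
have [v ->] := span w w1; exists (comb (v *m invmx (mult_mx c))); split.
  exact: comb_piece.
by rewrite mult_mxP mulmxKV.
Qed.

End LinearBasis.

(** * Passage from [S] to the residue ring [R] *)

Section Reduction.
Variables (k : fieldType) (N : nat) (S R : comAlgType k).
Variables (pi : {lrmorphism {mpoly k[N]} -> S}) (phi : {lrmorphism S -> R}) (f : S).
Hypotheses (S_graded : homogeneous_graded_ring pi) (f_deg2 : graded_piece pi 2 f).
Hypotheses (f_reg : GRing.lreg f) (phi_surj : forall y, exists x, phi x = y).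
Hypothesis phi_ker : [set x | phi x = 0] = ideal_gen [set f].

Let rho : {lrmorphism {mpoly k[N]} -> R} := phi \o pi.

Lemma phi_kerP s : phi s = 0 <-> exists t, s = t * f.
Proof.
split=> [s0|[t ->]].
  have : ideal_gen [set f] s by rewrite -phi_ker.
  move=> [m [a [b [bf ->]]]]; exists (\sum_i a i); rewrite mulr_suml.
  by apply: eq_bigr => i _; rewrite bf.
suff : [set x | phi x = 0] (t * f) by [].
by rewrite phi_ker; exists 1%N, (fun=> t), (fun=> f); rewrite big_ord1.
Qed.

(** As [f] is homogeneous, the components of [t f] are again multiples of [f]. *)
Lemma R_graded : homogeneous_graded_ring rho.
Proof.
split=> [y|p p0 d].
  by have [s <-] := phi_surj y; have [p <-] := S_graded.1 s; exists p.
have [t tE] := (phi_kerP (pi p)).1 p0; rewrite /rho /=; apply/phi_kerP.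
rewrite -(hcomp_pi S_graded) tE (hcompM S_graded _ _ f_deg2).
by case: ifP => _; [eexists | exists 0; rewrite mul0r].
Qed.

Lemma piece_phi d s : graded_piece pi d s -> graded_piece rho d (phi s).
Proof. by move=> [p hp <-]; exists p. Qed.

Lemma piece_lift d a : graded_piece rho d a -> exists2 s, graded_piece pi d s & phi s = a.
Proof. by move=> [p hp <-]; exists (pi p) => //; exists p. Qed.

(** Multiples of [f] have no component in degree one. *)
Lemma phi_inj1 s : graded_piece pi 1 s -> phi s = 0 -> s = 0.
Proof.
move=> /(pieceP S_graded) s1 /phi_kerP[t tE].
by rewrite -s1 tE (hcompM S_graded _ _ f_deg2).
Qed.

Lemma phi_ker2 s : graded_piece pi 2 s -> phi s = 0 -> exists c, s = c *: f.
Proof.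
move=> /(pieceP S_graded) s2 /phi_kerP[t tE]; exists (augmentation pi t).
by rewrite -s2 tE (hcompM S_graded _ _ f_deg2) /= hcomp0 mulr_algl.
Qed.

Lemma phi_f : phi f = 0.
Proof. by apply/phi_kerP; exists 1; rewrite mul1r. Qed.

(** A multiplier divides [f], and factors of a regular element are regular. *)
Lemma multiplier_lreg x : multiplier pi x -> GRing.lreg x.
Proof.
move=> [_ /(_ _ f_deg2)[w [_ fE]]] a b ab; apply: f_reg.
by rewrite fE mulrAC ab mulrAC.
Qed.

Variables (x y : S).
Hypotheses (x_mult : multiplier pi x) (y1 : graded_piece pi 1 y) (fE : f = x * y).

Lemma x_reg : GRing.lreg x.
Proof. exact: multiplier_lreg x_mult. Qed.

Lemma f_neq0 : f <> 0.
Proof.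
move=> f0; have /eqP : (1 : S) = 0 by apply: f_reg; rewrite f0 !mul0r.
by rewrite oner_eq0.
Qed.

(* A basis of [R_2] lifts, together with [f], to a basis of [S_2 = x S_1]. *)
Lemma linear_basis_exists : exists (r : nat) (gamma : 'I_r -> R^o) (beta : 'I_r.+1 -> S),
  is_basis (graded_piece rho 2 : set R^o) gamma /\ linear_basis pi beta.
Proof.
have [m [b spb]] := piece2_spanning R_graded.
have [r [gamma [gamma_span gamma_free]]] := basis_of_spanning (U := R^o) spb.
have gamma2 i : graded_piece rho 2 (gamma i).
  exact: (basis_mem (U := R^o) i (conj gamma_span gamma_free)).
have w_ex i : exists w, graded_piece pi 1 w /\ phi (x * w) = gamma i.
  have [h h2 hi] := piece_lift (gamma2 i).
  by have [w [w1 hE]] := x_mult.2 h h2; exists w; rewrite -hE.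
have [w wP] := choice w_ex.
(* The first vector is [y], with [x y = f]; multiplied by [x], the others lift the basis [gamma] of
   [R_2]. Hence the length [r.+1]. *)
pose beta (i : 'I_r.+1) := oapp w y (unlift ord0 i).
have beta0 : beta ord0 = y by rewrite /beta unlift_none.
have betaS i : beta (lift ord0 i) = w i by rewrite /beta liftK.
have xcomb u : x * comb beta u = u 0 0 *: f + \sum_i u 0 (lift ord0 i) *: (x * w i).
  rewrite /comb big_ord_recl beta0 mulrDr -scalerAr -fE; congr (_ + _).
  by rewrite mulr_sumr; apply: eq_bigr => i _; rewrite betaS scalerAr.
have phi_xcomb u : phi (x * comb beta u) = lin_comb gamma (fun i => u 0 (lift ord0 i)).
  rewrite xcomb lin_combE linearD linearZ /= phi_f scaler0 add0r linear_sum.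
  by apply: eq_bigr => i _; rewrite linearZ /=; congr (_ *: _); exact: (wP i).2.
exists r, gamma, beta; split; first by split.
have beta1 i : graded_piece pi 1 (beta i).
  by case: (unliftP ord0 i) => [j ->|->]; rewrite ?betaS ?beta0 //; exact: (wP j).1.
split=> // [s s1|u u0].
  have := piece_phi (pieceM (x_mult.1) s1); rewrite gamma_span => -[c _ cE].
  pose u := \row_i oapp c 0 (unlift ord0 i).
  have uc i : u 0 (lift ord0 i) = c i by rewrite mxE liftK.
  have u1 : graded_piece pi 1 (comb beta u).
    by apply: (piece_sum S_graded) => i _; apply: (pieceZ S_graded).
  (* After multiplication by [x], the element [s] and the combination agree only modulo [f]. The
     difference is [d f = x (d y)], and cancelling [x] leaves a correction along [y]. *)
  have [||d dE] := phi_ker2 (s := x * (s - comb beta u)) _ _.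
  - apply: (pieceM (d := 1) (e := 1)); first exact: x_mult.1.
    by rewrite -scaleN1r; apply: (pieceD S_graded) => //; apply: (pieceZ S_graded).
  - rewrite mulrBr raddfB /= phi_xcomb -cE; apply/eqP; rewrite subr_eq0; apply/eqP.
    by apply: eq_bigr => i _; rewrite uc.
  exists (u + d *: delta_mx 0 ord0); rewrite linearD linearZ /=.
  have -> : comb beta (delta_mx 0 ord0) = y.
    rewrite /comb (bigD1 ord0) //= mxE !eqxx scale1r beta0 big1 ?addr0 // => j /negPf ne.
    by rewrite mxE ne andbF scale0r.
  apply/eqP; rewrite addrC -subr_eq; apply/eqP; apply: x_reg.
  by rewrite -[RHS]scalerAr -fE -dE.
(* Modulo [f] the relation involves only [gamma], which is free; what remains is a scalar multiple
   of the nonzero element [f]. *)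
have uS i : u 0 (lift ord0 i) = 0.
  by apply: (gamma_free (fun i => u 0 (lift ord0 i))); rewrite -phi_xcomb u0 mulr0 raddf0.
apply/matrixP => a i; rewrite ord1 mxE; case: (unliftP ord0 i) => [j ->|->]; first exact: uS.
have := xcomb u; rewrite u0 mulr0 big1 => [|j _]; last by rewrite uS scale0r.
rewrite addr0 => /esym/eqP; apply: contraTeq => u00.
apply/eqP => /(congr1 ( *:%R (u 0 0)^-1)); rewrite scalerA mulVf // scale1r scaler0.
exact: f_neq0.
Qed.

End Reduction.

(** * The ring R *)

Section ShortRing.
Variables (k : fieldType) (N : nat) (S R : comAlgType k).
Variables (pi : {lrmorphism {mpoly k[N]} -> S}) (phi : {lrmorphism S -> R}) (f : S).
Hypotheses (S_graded : homogeneous_graded_ring pi) (f_deg2 : graded_piece pi 2 f).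
Hypotheses (f_reg : GRing.lreg f) (phi_surj : forall y, exists x, phi x = y).
Hypothesis phi_ker : [set x | phi x = 0] = ideal_gen [set f].

Let rho : {lrmorphism {mpoly k[N]} -> R} := phi \o pi.
Let rho_graded : homogeneous_graded_ring rho :=
  R_graded S_graded f_deg2 phi_surj phi_ker.
Let eps := augmentation_rmorphism rho_graded.

Variables (x y : S).
Hypotheses (x_mult : multiplier pi x) (y1 : graded_piece pi 1 y) (fE : f = x * y).
Variables (r : nat) (gamma : 'I_r -> R^o) (beta : 'I_r.+1 -> S).
Hypotheses (gamma_basis : is_basis (graded_piece rho 2 : set R^o) gamma)
  (beta_basis : linear_basis pi beta).

Let x_reg : GRing.lreg x := multiplier_lreg f_deg2 f_reg x_mult.

(** As a factor of [f], [y] is regular, so its multiplication matrix is invertible. *)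
Lemma y_mult : multiplier pi y.
Proof.
have y_reg : GRing.lreg y by move=> a b ab; apply: f_reg; rewrite fE -!mulrA ab.
have [T TP] := structure_matrices beta_basis x_mult.
have [_ span _] := beta_basis; have [c yE] := span y y1.
rewrite yE; apply: (unit_multiplier S_graded beta_basis x_mult TP).
by apply: (lreg_unit beta_basis TP); rewrite -yE.
Qed.

(** [S_3 = S_1 S_2 = S_1 y S_1] lies in [y S_2 = y x S_1 = f S_1]; higher degrees follow by
    splitting off variables. *)
Lemma piece3_eq0 d a : graded_piece rho d.+3 a -> a = 0.
Proof.
elim: d a => [|d IH] a.
  move=> /piece_lift[s s3 <-]; have [q [q2 ->]] := pieceS S_graded s3.
  have [w wP] := choice (fun i => y_mult.2 _ (q2 i)).
  have w2 : graded_piece pi 2 (\sum_i pi 'X_i * w i).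
    apply: (piece_sum S_graded) => i _; apply: (pieceM (d := 1) (e := 1)).
      exact: piece_X.
    exact: (wP i).1.
  have [t [_ tE]] := x_mult.2 _ w2.
  apply/(phi_kerP phi_ker); exists t; rewrite fE.
  have -> : \sum_i pi 'X_i * q i = y * \sum_i pi 'X_i * w i.
    by rewrite mulr_sumr; apply: eq_bigr => i _; rewrite (wP i).2 mulrCA.
  by rewrite tE mulrCA mulrA mulrC [x * y]mulrC.
move=> /(pieceS rho_graded)[q [q3 ->]]; rewrite big1 // => i _.
by rewrite (IH _ (q3 i)) mulr0.
Qed.

Lemma hcomp_dec a : a = hcomp rho 0 a + (hcomp rho 1 a + hcomp rho 2 a).
Proof.
have [n an] := hcomp_sum rho_graded a.
rewrite {1}(an n.+3) ?leqW // !big_ord_recl big1 ?addr0 // => i _.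
exact: (piece3_eq0 (hcompP rho i.+3 a)).
Qed.

Lemma max_ideal_dec a : eps a = 0 -> a = hcomp rho 1 a + hcomp rho 2 a.
Proof. by move=> a0; rewrite {1}[a]hcomp_dec hcomp0 [augmentation _ _]a0 scale0r add0r. Qed.

Lemma piece_mul_eq0 d e a b : (2 < d + e)%N ->
  graded_piece rho d a -> graded_piece rho e b -> a * b = 0.
Proof.
move=> de ad be; have := pieceM ad be; case: (d + e)%N de => [|[|[|n]]] // _ ab.
exact: (piece3_eq0 ab).
Qed.

Lemma max_ideal_mul a b : eps a = 0 -> eps b = 0 -> graded_piece rho 2 (a * b).
Proof.
move=> /max_ideal_dec aE /max_ideal_dec bE.
have a_ d := hcompP rho d a; have b_ d := hcompP rho d b.
rewrite aE bE mulrDl !mulrDr (piece_mul_eq0 _ (a_ 1%N) (b_ 2%N)) //.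
rewrite (piece_mul_eq0 _ (a_ 2%N) (b_ 1%N)) // (piece_mul_eq0 _ (a_ 2%N) (b_ 2%N)) //.
by rewrite !addr0; apply: (pieceM (d := 1) (e := 1)).
Qed.

Lemma max_ideal_piece2 a b : eps a = 0 -> graded_piece rho 2 b -> a * b = 0.
Proof.
move=> /max_ideal_dec-> b2; rewrite mulrDl.
rewrite (piece_mul_eq0 _ (hcompP rho 1 a) b2) //.
by rewrite (piece_mul_eq0 _ (hcompP rho 2 a) b2) // addr0.
Qed.

Lemma max_ideal_cube a b c : eps a = 0 -> eps b = 0 -> eps c = 0 -> a * b * c = 0.
Proof.
move=> a0 b0 c0; rewrite mulrC; apply: max_ideal_piece2 => //.
exact: max_ideal_mul.
Qed.

Lemma phi_comb_inj u v : phi (comb beta u) = phi (comb beta v) -> u = v.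
Proof.
move=> uv; apply/eqP; rewrite -subr_eq0; apply/eqP; have [_ _ free] := beta_basis.
apply: free; apply: (phi_inj1 S_graded f_deg2 phi_ker).
  exact: (comb_piece S_graded beta_basis).
by rewrite !raddfB /= uv subrr.
Qed.

Lemma piece1_comb a : graded_piece rho 1 a -> exists u, a = phi (comb beta u).
Proof.
move=> /piece_lift[s s1 <-]; have [_ span _] := beta_basis.
by have [u ->] := span s s1; exists u.
Qed.

Lemma lin_comb_phi c :
  lin_comb (fun i => phi (beta i) : R^o) c = phi (comb beta (\row_i c i)).
Proof.
rewrite lin_combE linear_sum; apply: eq_bigr => i _.
by rewrite mxE linearZ.
Qed.

(** [phi] is bijective in degree one, so [R_1] inherits the basis of [S_1] and has dimension
    [r + 1]. *)
Lemma piece1_basis :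
  is_basis (graded_piece rho 1 : set R^o) (fun i => phi (beta i) : R^o).
Proof.
split; last first.
  move=> c; rewrite lin_comb_phi -(raddf0 phi) -(raddf0 (comb beta)) => /phi_comb_inj/matrixP c0 i.
  by have := c0 0 i; rewrite !mxE.
apply/seteqP; split=> [a /piece1_comb[u ->]|_ [c _ <-]].
  exists (fun i => u 0 i) => //; rewrite lin_comb_phi; congr (phi (comb _ _)).
  by apply/rowP => i; rewrite mxE.
by rewrite lin_comb_phi; apply/piece_phi/(comb_piece S_graded beta_basis).
Qed.

(** A linear form on [R_1] that separates [a] from the line of [b], extended to [R] through the
    degree-one component. *)
Lemma separating_form a b : graded_piece rho 1 a -> graded_piece rho 1 b ->
  (forall c, a <> c *: b) -> exists D : {additive R -> k},
    [/\ D a = 1, D b = 0 & forall l, graded_piece rho 1 l -> scales_on eps D l].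
Proof.
move=> a1 b1 ab.
have [u uP] := choice (fun t => piece1_comb (hcompP rho 1 t)).
have u1 t : graded_piece rho 1 t -> t = phi (comb beta (u t)).
  by move=> /(pieceP rho_graded) t1; rewrite -{1}t1 uP.
have uB : zmod_morphism u.
  by move=> s t; apply: phi_comb_inj; rewrite -uP !raddfB /= -!uP.
have uZ t l : graded_piece rho 1 l -> u (t * l) = eps t *: u l.
  move=> l1; apply: phi_comb_inj; rewrite -uP (hcomp1M rho_graded _ l1).
  by rewrite !linearZ /= -u1.
have : ~~ (u a <= u b)%MS.
  apply/sub_rVP => -[c uab]; apply: (ab c).
  by rewrite (u1 a) // (u1 b) // uab !linearZ.
rewrite submxE => /eqP coker0; pose C := cokermx (u b).
have [j Cj] : exists j, (u a *m C) 0 j != 0.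
  apply: contrapT => /forallNP h; apply: coker0; apply/rowP => j.
  by rewrite [RHS]mxE; apply/eqP/negPn/negP/h.
(* A column of the cokernel matrix of [u b] is a functional vanishing at [u b]; it is scaled to be 1
   at [u a]. *)
pose d t := (u t *m C) 0 j / (u a *m C) 0 j.
have dB : zmod_morphism d.
  by move=> s t; rewrite /d uB mulmxBl mxE [X in _ + X]mxE mulrBl.
pose D : {additive R -> k} := HB.pack d (GRing.isZmodMorphism.Build R k d dB).
exists D; split; first exact: divff.
  by rewrite -[LHS]/(d b) /d mulmx_coker mxE mul0r.
move=> l l1 t; rewrite -[D (t * l)]/(d (t * l)) -[D l]/(d l) /d uZ //.
by rewrite -scalemxAl mxE mulrA.
Qed.

(** If the linear part of a socle element lifts to [s], then [s S_1] lies in [k f]; in particular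
    [s x = c f], so [s = c y]. If [c] were nonzero, [S_1] would be [k x] and [R_2] would vanish,
    against [r > 0]. *)
Lemma socleP t : (0 < r)%N ->
  (forall a, eps a = 0 -> a * t = 0) <-> graded_piece rho 2 t.
Proof.
move=> r_gt0; split=> [soc|t2 a a0]; last exact: max_ideal_piece2.
have soc1 l : graded_piece rho 1 l -> t * l = 0.
  by move=> l1; rewrite mulrC; apply: soc; apply: (augmentation_piece rho_graded l1).
pose l0 := phi (beta ord0).
have l0_1 : graded_piece rho 1 l0 by have [b1 _ _] := beta_basis; exact: piece_phi.
have t0 : eps t = 0.
  apply: contrapT => /eqP t0; apply: (basis_neq0 (i := ord0) piece1_basis).
  apply: (scalerI t0); rewrite scaler0 -(hcomp1M rho_graded t l0_1) soc1 //.
  by rewrite raddf0.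
have soc2 l : graded_piece rho 1 l -> hcomp rho 1 t * l = 0.
  by move=> l1; have := hcompM rho_graded t 2 l1; rewrite soc1 // raddf0.
have [s s1 sE] := piece_lift (hcompP rho 1 t).
suff t1 : hcomp rho 1 t = 0.
  by rewrite [t](max_ideal_dec t0) t1 add0r; exact: hcompP.
have sl l : graded_piece pi 1 l -> exists c, s * l = c *: f.
  move=> l1; apply: (phi_ker2 S_graded f_deg2 phi_ker).
    exact: (pieceM (d := 1) (e := 1)).
  by rewrite rmorphM /= sE; apply: soc2; exact: piece_phi.
have [c sx] := sl x x_mult.1.
have sE' : s = c *: y.
  by apply: x_reg; rewrite -scalerAr -fE -sx mulrC.
rewrite -sE sE'; have [->|c0] := eqVneq c 0; first by rewrite scale0r raddf0.
exfalso.
(* From [y l] in [k f = k y x], cancelling [y] makes every linear form a multiple of [x]. *)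
have lx l : graded_piece pi 1 l -> exists d, l = d *: x.
  move=> l1; have [d dE] := sl l l1; exists (c^-1 * d).
  have y_reg : GRing.lreg y by move=> a b ab; apply: f_reg; rewrite fE -!mulrA ab.
  apply: y_reg; rewrite -scalerAr [y * x]mulrC -fE -scalerA -dE sE'.
  by rewrite -scalerAl scalerA mulVf // scale1r.
have [d yE] := lx y y1.
have xx : phi (x * x) = 0.
  have d0 : d != 0.
    apply: contra_notN (f_neq0 f_reg) => /eqP d0.
    by rewrite fE yE d0 scale0r mulr0.
  apply: (scalerI d0); rewrite scaler0 -linearZ scalerAr -yE -fE.
  exact: phi_f phi_ker.
have gamma2 : graded_piece rho 2 (gamma (Ordinal r_gt0)) := basis_mem _ gamma_basis.
apply: (basis_neq0 (i := Ordinal r_gt0) gamma_basis).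
have [h h2 <-] := piece_lift gamma2; have [w [w1 ->]] := x_mult.2 h h2.
by have [d' ->] := lx w w1; rewrite -scalerAr linearZ /= xx scaler0.
Qed.

(** Here [R_2 = 0] and [R_1] is a line, so [R] is the ring of dual numbers. *)
Lemma gorenstein_of_piece2_eq0 : r = 0%N -> gorenstein R.
Proof.
move=> r0; pose v := phi (beta ord0).
have v1 : graded_piece rho 1 v by have [b1 _ _] := beta_basis; exact: piece_phi.
have v0 : v <> 0 := basis_neq0 (i := ord0) piece1_basis.
have piece2_eq0 a : graded_piece rho 2 a -> a = 0.
  rewrite gamma_basis.1 => -[c _ <-]; rewrite lin_combE big1 // => i _.
  by have := ltn_ord i; rewrite {2}r0.
have piece1_v a : graded_piece rho 1 a -> exists c, a = c *: v.
  move=> /piece1_comb[u ->]; exists (u 0 ord0); rewrite /comb.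
  rewrite raddf_sum (bigD1 ord0) //= linearZ /= big1 ?addr0 // => i.
  rewrite -val_eqE /= => ne; have : (i < 0.+1)%N by rewrite -[in 0.+1]r0 ltn_ord.
  by rewrite ltnS leqn0 (negPf ne).
have [im imP] := choice (fun a => piece1_v _ (hcompP rho 1 a)).
apply: (@gorenstein_dual_numbers k R v (augmentation rho) im).
- move=> a; rewrite -imP -hcomp0 {1}[a]hcomp_dec.
  by rewrite [hcomp rho 2 a]piece2_eq0 ?addr0 //; exact: hcompP.
- by apply: piece2_eq0; apply: (pieceM (d := 1) (e := 1)).
move=> c d cd0.
have c0 : c = 0.
  have := congr1 eps cd0; rewrite rmorph0 rmorphD /= augmentationC //.
  by rewrite (augmentation_piece rho_graded (pieceZ rho_graded d v1)) addr0.
split=> //; move: cd0; rewrite c0 scale0r add0r => dv; apply: contrapT => /eqP d0.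
by apply: v0; apply: (scalerI d0); rewrite dv scaler0.
Qed.

End ShortRing.

(** * Openness and the socle *)

Section HomogeneousDeterminant.
Variables (k : fieldType) (n : nat).

Lemma dhomog_prod_ord m (F : 'I_m -> {mpoly k[n]}) :
  (forall i, F i \is 1.-homog) -> \prod_i F i \is m.-homog.
Proof.
elim: m F => [|m IH] F F1; first by rewrite big_ord0 dhomog1.
by rewrite big_ord_recl; apply: (dhomogM (d := 1)) => //; apply: IH.
Qed.

Lemma dhomog_det m (M : 'M[{mpoly k[n]}]_m) :
  (forall i j, M i j \is 1.-homog) -> \det M \is m.-homog.
Proof.
move=> M1; apply: rpred_sum => s _; rewrite rpredMsign.
exact: dhomog_prod_ord.
Qed.

End HomogeneousDeterminant.

Section Line.
Variables (k : fieldType) (R : comAlgType k).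
Implicit Types (a : R) (p : set R^o).

Definition line a : set R^o := range (fun c : k => c *: a).

Lemma line_mem a : line a a.
Proof. by exists 1; rewrite ?scale1r. Qed.

Lemma line_scale (c : k) a : c != 0 -> line (c *: a) = line a.
Proof.
move=> c0; apply/seteqP; split=> _ [d _ <-].
  by exists (d * c); rewrite ?scalerA.
by exists (d / c); rewrite // scalerA divfK.
Qed.

Lemma line_lin_comb (b : 'I_1 -> R^o) : range (lin_comb b) = line (b ord0).
Proof.
apply/seteqP; split=> _ [c _ <-].
  by exists (c ord0); rewrite // lin_combE big_ord1.
by exists (fun=> c); rewrite // lin_combE big_ord1.
Qed.

Lemma line_projective (W : set R^o) a : a <> 0 -> line a `<=` W ->
  projective_space W (line a).
Proof.
move=> a0 aW; split=> //; exists (fun=> a); split; first by rewrite line_lin_comb.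
move=> c; rewrite lin_combE big_ord1 => ca i; rewrite [i]ord1.
apply: contrapT => /eqP ci; apply: a0; apply: (scalerI ci).
by rewrite scaler0.
Qed.

Lemma projective_line (W : set R^o) p v : projective_space W p -> p v -> v <> 0 ->
  p = line v.
Proof.
move=> [_ [b [-> _]]]; rewrite line_lin_comb => -[c _ <-] cb.
by rewrite line_scale //; apply: contra_notN cb => /eqP->; rewrite scale0r.
Qed.

End Line.

Section SocleDimension.
Variables (k : fieldType) (N : nat) (R : comAlgType k).
Variable rho : {lrmorphism {mpoly k[N]} -> R}.
Hypothesis rho_graded : homogeneous_graded_ring rho.
Let eps := augmentation_rmorphism rho_graded.
Variables (r : nat) (gamma : 'I_r -> R^o).
Hypothesis gamma_basis : is_basis (graded_piece rho 2 : set R^o) gamma.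
Hypothesis socleP : forall t,
  (forall a, eps a = 0 -> a * t = 0) <-> graded_piece rho 2 t.
Hypothesis r_gt0 : (0 < r)%N.

Let s : R := gamma (Ordinal r_gt0).

Let s2 : graded_piece rho 2 s := basis_mem _ gamma_basis.
Let s_neq0 : s <> 0 := basis_neq0 gamma_basis.

Let mul_s (t : R^o) : R^o := t * s.

Lemma mul_s_is_linear : linear mul_s.
Proof. by move=> a t u; rewrite /mul_s mulrDl -scalerAl. Qed.

HB.instance Definition _ := GRing.isLinear.Build R R^o R^o *:%R mul_s mul_s_is_linear.

(* [R s] is the residue field, as [s] lies in the socle. *)
Let K : lmodType R := image_module mul_s.
Let q : {linear R^o -> K} := to_image mul_s.

Let q_eq0 t : q t = 0 <-> eps t = 0.
Proof.
split=> [/to_image_eq0 ts|t0]; last by apply/to_image_eq0/(socleP s).2.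
have := hcompM rho_graded t 2 s2.
rewrite [t * s]ts raddf0 // ltnSn subnn hcomp0 mulr_algl => /esym ts0.
by apply: contrapT => /eqP t0; apply: s_neq0; apply: (scalerI t0); rewrite ts0 scaler0.
Qed.

Let q_eq t t' a : graded_piece rho 2 a -> q t = q t' -> t * a = t' * a.
Proof.
move=> a2 tt'; apply/eqP; rewrite -subr_eq0 -mulrBl; apply/eqP/(socleP a).2 => //.
by apply/q_eq0; rewrite raddfB /= tt' subrr.
Qed.

(** Sending the class of [t] to [t a] is well defined because the maximal ideal kills [a]. *)
Let dual_of a : graded_piece rho 2 a -> exists g : dual K, forall t, g (q t) = t * a.
Proof.
move=> a2; have [l lP] := choice (to_image_surj (h := mul_s)).
have g_lin : (fun x : K => l x * a : R^o) \in linear_pred (M := K).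
  apply/asboolP => c x y /=; rewrite -[c *: (l x * a : R^o)]/(c * (l x * a)) mulrA -mulrDl.
  by apply: q_eq => //; rewrite -[c * _]/(c *: (l x : R^o)) linearP /= /q !lP.
by exists (Dual g_lin) => t /=; apply: q_eq => //; exact: lP.
Qed.

(** A map from the residue field to [R] is determined by the image of the class of 1, which can be
    any socle element; this identifies the dual of [K] with [R_2]. *)
Lemma socle_dim_basis : socle_dim rho r.
Proof.
exists K, q; split; first exact: to_image_surj.
  apply/seteqP; split=> t /=.
    by move=> /q_eq0 t0; apply/(graded_max_idealP rho_graded).
  by move=> /(graded_max_idealP rho_graded) t0; apply/q_eq0.
have [g gP] := choice (fun i => dual_of (basis_mem i gamma_basis)).
have combP c t : (lin_comb g c : dual K) (q t) = t * lin_comb gamma c.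
  rewrite -[LHS]/(biduality (q t) (lin_comb g c)) linear_sum lin_combE mulr_sumr.
  apply: eq_bigr => i _; rewrite linearZ /= gP -[_ *: _]/(_ * _) mulr_algl.
  by rewrite scalerAr.
exists g; split=> [|c c0]; last first.
  apply: gamma_basis.2; rewrite -[LHS]mul1r -combP c0 //.
apply/esym; rewrite -subTset => h _.
have h1_2 : graded_piece rho 2 (h (q 1)).
  apply/socleP => a /q_eq0 a0; rewrite -[_ * _]/(a *: h (q 1)) -linearZ /= -linearZ.
  by rewrite -[a *: 1]/(a * 1) mulr1 a0 raddf0.
move: h1_2; rewrite gamma_basis.1 => -[c _ cE]; exists c => //.
apply: val_inj; apply: funext => x; have [t <-] := to_image_surj x.
apply: etrans (combP c t) _; rewrite cE.
by rewrite -[t * _]/(t *: h (q 1)) -linearZ /= -linearZ -[t *: 1]/(t * 1) mulr1.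
Qed.

End SocleDimension.

(** * The family *)

Section Family.
Variables (k : fieldType) (N : nat) (S R : comAlgType k).
Variables (pi : {lrmorphism {mpoly k[N]} -> S}) (phi : {lrmorphism S -> R}) (f : S).
Hypotheses (S_graded : homogeneous_graded_ring pi) (f_deg2 : graded_piece pi 2 f).
Hypotheses (f_reg : GRing.lreg f) (phi_surj : forall y, exists x, phi x = y).
Hypothesis phi_ker : [set x | phi x = 0] = ideal_gen [set f].

Let rho : {lrmorphism {mpoly k[N]} -> R} := phi \o pi.
Let rho_graded : homogeneous_graded_ring rho :=
  R_graded S_graded f_deg2 phi_surj phi_ker.
Let eps := augmentation_rmorphism rho_graded.

Variables (x y : S).
Hypotheses (x_mult : multiplier pi x) (y1 : graded_piece pi 1 y) (fE : f = x * y).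
Variables (r : nat) (gamma : 'I_r -> R^o) (beta : 'I_r.+1 -> S).
Hypotheses (gamma_basis : is_basis (graded_piece rho 2 : set R^o) gamma)
  (beta_basis : linear_basis pi beta) (r_gt0 : (0 < r)%N).

Let V : set R^o := graded_piece rho 1.
Let mult_lreg t : multiplier pi t -> GRing.lreg t :=
  fun t_mult => multiplier_lreg f_deg2 f_reg t_mult.

Definition multiplier_lines : set (set R^o) :=
  [set p | exists2 t, multiplier pi t & p = line (phi t)].

Lemma phi_multiplier_neq0 t : multiplier pi t -> phi t <> 0.
Proof.
move=> t_mult /(phi_inj1 S_graded f_deg2 phi_ker t_mult.1) t0.
have /eqP : (1 : S) = 0 by apply: (mult_lreg t_mult); rewrite t0 !mul0r.
by rewrite oner_eq0.
Qed.

Lemma line_subset t : graded_piece pi 1 t -> line (phi t) `<=` V.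
Proof.
by move=> t1 _ [c _ <-]; apply: (pieceZ rho_graded); exact: piece_phi.
Qed.

(** A linear form is a multiplier exactly when its matrix [mult_mx] is invertible. The complement is
    thus the zero locus of one determinant, homogeneous of degree [r + 1] in the coordinates. *)
Lemma multiplier_lines_open : zariski_open V multiplier_lines.
Proof.
split=> [p [t t_mult ->]|].
  by apply: line_projective; [exact: phi_multiplier_neq0|exact: line_subset t_mult.1].
have [T TP] := structure_matrices beta_basis x_mult.
pose M : 'M[{mpoly k[r.+1]}]_r.+1 := \matrix_(i, l) \sum_j T j i l *: 'X_j.
have M_eval c : (\det M).@[c] = \det (mult_mx T (\row_j c j)).
  rewrite -det_map_mx; congr (\det _); apply/matrixP => i l.
  rewrite !mxE raddf_sum summxE; apply: eq_bigr => j _.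
  by rewrite /= mevalZ mevalXU !mxE mulrC.
have unitP c : (\det M).@[c] != 0 <-> multiplier pi (comb beta (\row_j c j)).
  rewrite M_eval -unitfE -unitmxE; split; last by move=> /mult_lreg /(lreg_unit beta_basis TP).
  exact: (unit_multiplier S_graded beta_basis x_mult TP).
exists r.+1, (fun i => phi (beta i)), [set \det M]; split.
- exact: (piece1_basis S_graded f_deg2 phi_ker beta_basis).
- move=> _ ->; exists r.+1; apply: dhomog_det => i l; rewrite mxE.
  by apply: rpred_sum => j _; apply: dhomogZ; rewrite dhomogX; apply/eqP; exact: mdeg1.
apply/seteqP; split=> p [pV].
  move=> pO; split=> // _ c -> pc; apply: contrapT => /eqP/unitP c_mult; apply: pO.
  exists (comb beta (\row_j c j)) => //; rewrite -lin_comb_phi.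
  apply: (projective_line pV pc); rewrite lin_comb_phi.
  exact: phi_multiplier_neq0.
move=> p0; split=> // -[t t_mult pE].
have [_ span _] := beta_basis; have [u tE] := span t t_mult.1.
have uE : \row_j u 0 j = u by apply/rowP => j; rewrite mxE.
have := (unitP (fun j => u 0 j)).2; rewrite uE -tE => /(_ t_mult).
rewrite p0 ?eqxx // lin_comb_phi uE -tE pE; exact: line_mem.
Qed.

Lemma multiplier_lines_neq0 : multiplier_lines !=set0.
Proof. by exists (line (phi x)), x. Qed.

(** [R_1] has dimension [r + 1 > 1], so it is not spanned by [phi t]. *)
Lemma transversal_element t : multiplier pi t ->
  exists2 z, graded_piece pi 1 z & forall c, phi z <> c *: phi t.
Proof.
move=> t_mult; apply: contrapT => no_z.
have [b1 _ free] := beta_basis.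
have prop i : exists c, phi (beta i) = c *: phi t.
  by apply: contrapT => /forallNP h; apply: no_z; exists (beta i).
have [c cP] := choice prop.
pose i1 : 'I_r.+1 := Ordinal (r_gt0 : (1 < r.+1)%N).
(* If the first two basis vectors are [c0] and [c1] times [phi t], then [c1] times the first minus
   [c0] times the second is zero. *)
have rel : lin_comb (fun i => phi (beta i) : R^o)
    (fun i => if i == ord0 then c i1 else if i == i1 then - c ord0 else 0) = 0.
  rewrite lin_combE (bigD1 ord0) //= (bigD1 i1) //= big1 => [|i /andP[/negPf-> /negPf->]];
    last exact: scale0r.
  by rewrite !cP !scalerA addr0 -scalerDl mulNr mulrC subrr scale0r.
have [_ ind] := piece1_basis S_graded f_deg2 phi_ker beta_basis.
have c1 := ind _ rel ord0; rewrite eqxx in c1.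
apply: (basis_neq0 (i := i1) (piece1_basis S_graded f_deg2 phi_ker beta_basis)).
by rewrite cP c1 scale0r.
Qed.

(** The product of [z] with a linear form lies in [S_2 = t S_1], so division by [t] can be repeated
    without leaving degree one. *)
Lemma cofactor_sequence t z : multiplier pi t -> graded_piece pi 1 z ->
  exists g : nat -> S, t * g 0%N = f /\ forall i, t * g i.+1 = - (z * g i).
Proof.
move=> t_mult z1; have [w0 [w01 w0E]] := t_mult.2 f f_deg2.
(* The implication makes the step total on [S]; outside degree one the value 0 is a mere default. *)
have step_ex w : exists w', graded_piece pi 1 w -> graded_piece pi 1 w' /\ t * w' = - (z * w).
  have [w1|nw1] := pselect (graded_piece pi 1 w); last by exists 0.
  have zw : graded_piece pi 2 (- (z * w)).
    by rewrite -scaleN1r; apply: (pieceZ S_graded); apply: (pieceM (d := 1) (e := 1)).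
  by have [w' [w'1 ->]] := t_mult.2 _ zw; exists w'.
have [step stepP] := choice step_ex.
exists (fun i => iter i step w0); split=> // i.
have : graded_piece pi 1 (iter i step w0).
  by elim: i => [|i /stepP[]].
by move=> /stepP[].
Qed.

Section Member.
Variables (t z : S) (g : nat -> S) (n : nat).
Hypotheses (t_mult : multiplier pi t) (z1 : graded_piece pi 1 z)
  (tz : forall c, phi z <> c *: phi t)
  (tg0 : t * g 0%N = f) (tgS : forall i, t * g i.+1 = - (z * g i)).

Let A : 'M[R]_n.+1 := map_mx phi (jordan_mx t z n.+1).
Let B : 'M[R]_n.+1 := map_mx phi (jordan_cofactor g n).

Lemma member_exact : exact_pair A B.
Proof.
have [AB BA] := jordan_factorization n tg0 tgS.
exact: (matrix_factorization_exact f_reg phi_surj (phi_kerP phi_ker)).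
Qed.

Lemma member_exact_tr : exact_pair A^T B^T.
Proof.
have [AB BA] := jordan_factorization n tg0 tgS.
exact: (matrix_factorization_exact_tr f_reg phi_surj (phi_kerP phi_ker)).
Qed.

Let AE : A = jordan_mx (phi t) (phi z) n.+1.
Proof. by rewrite /A /jordan_mx map_mxD map_scalar_mx map_mxZ map_shift_mx. Qed.

Lemma member_entry i j : graded_piece rho 1 (A i j).
Proof.
rewrite AE !mxE; apply: (pieceD rho_graded).
  by case: (i == j) => /=; [exact: piece_phi t_mult.1|exact: piece0].
case: (_ == _) => /=; first by rewrite mulr1; exact: piece_phi z1.
by rewrite mulr0; exact: piece0.
Qed.

Lemma map_member (D : {additive R -> k}) :
  map_mx D A = jordan_mx (D (phi t)) (D (phi z)) n.+1.
Proof.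
apply/matrixP => i j; rewrite AE !mxE raddfD /= raddfMn; congr (_ + _).
by rewrite !mulr_natr raddfMn.
Qed.

Lemma member_eps : map_mx eps A = 0.
Proof.
apply/matrixP => i j; rewrite mxE [RHS]mxE.
exact: (augmentation_piece rho_graded (member_entry i j)).
Qed.

Lemma member_min_gen : minimally_generated_by (column_module B) n.+1.
Proof. exact: column_module_min_gen member_exact member_eps. Qed.

Lemma member_gdim : gdim_zero (column_module B).
Proof. exact: gdim_zero_column_module member_exact member_exact_tr. Qed.

(** As [phi t] and [phi z] are independent, there are forms [D1] and [D2] dual to them, which read
    off the identity and the shift in [A]. *)
Lemma member_indecomposable : indecomposable (column_module B).
Proof.
have t1 := piece_phi phi t_mult.1; have z1' := piece_phi phi z1.
have zt c : phi t <> c *: phi z.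
  have [->|c0] := eqVneq c 0; first by rewrite scale0r; exact: phi_multiplier_neq0.
  by move=> tE; apply: (tz (c := c^-1)); rewrite tE scalerA mulVf // scale1r.
have sep := separating_form S_graded f_deg2 phi_surj phi_ker beta_basis.
have [D1 [D1t D1z D1P]] := sep _ _ t1 z1' zt.
have [D2 [D2z D2t D2P]] := sep _ _ z1' t1 tz.
apply: (column_module_indecomposable member_exact member_eps _ (D1 := D1) (D2 := D2)) => //.
- exact: (max_ideal_cube f_reg x_mult y1 fE beta_basis).
- by move=> i j; apply: D1P; exact: member_entry.
- by move=> i j; apply: D2P; exact: member_entry.
- by rewrite map_member D1t D1z /jordan_mx scale0r addr0.
- by rewrite map_member D2t D2z /jordan_mx scale1r raddf0 add0r.
Qed.

End Member.

(** A form equal to 1 at [phi t] and 0 at [phi t'] makes one matrix unipotent and the other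
    nilpotent. *)
Lemma member_not_isomorphic t z g t' z' g' n :
  multiplier pi t -> graded_piece pi 1 z ->
  t * g 0%N = f -> (forall i, t * g i.+1 = - (z * g i)) ->
  multiplier pi t' -> graded_piece pi 1 z' ->
  t' * g' 0%N = f -> (forall i, t' * g' i.+1 = - (z' * g' i)) ->
  line (phi t) <> line (phi t') ->
  ~ isomorphic (column_module (map_mx phi (jordan_cofactor g n)))
               (column_module (map_mx phi (jordan_cofactor g' n))).
Proof.
move=> t_mult z1 tg0 tgS t'_mult z'1 t'g0 t'gS tt'.
have tt'c c : phi t <> c *: phi t'.
  have [->|c0] := eqVneq c 0; first by rewrite scale0r; exact: phi_multiplier_neq0.
  by move=> tE; apply: tt'; rewrite tE line_scale.
have [D [Dt Dt' DP]] := separating_form S_graded f_deg2 phi_surj phi_ker beta_basis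
  (piece_phi phi t_mult.1) (piece_phi phi t'_mult.1) tt'c.
apply: (column_module_not_isomorphic (ltn0Sn n) (member_exact n tg0 tgS)
  (member_exact n t'g0 t'gS) (member_eps n t_mult z1) (D := D)).
- by move=> i j; apply: DP; exact: member_entry.
- by move=> i j; apply: DP; exact: member_entry.
- by rewrite map_member Dt; reflexivity.
- by rewrite map_member Dt' /jordan_mx raddf0 add0r; reflexivity.
Qed.

End Family.

Theorem theorem5p1 (k : closedFieldType) (N : nat) (S R : comAlgType k)
  (pi : {lrmorphism {mpoly k[N]} -> S}) (phi : {lrmorphism S -> R}) (f : S)
  (S_graded : homogeneous_graded_ring pi)
  (S_dim1 : krull_dim S 1)
  (S_CM : cohen_macaulay pi)
  (S_minmult : minimal_multiplicity pi)
  (f_deg2 : graded_piece pi 2 f)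
  (f_reg : GRing.lreg f)
  (phi_surj : forall y, exists x, phi x = y)
  (phi_ker : [set x | phi x = 0] = ideal_gen [set f])
  (R_not_gorenstein : ~ gorenstein R) :
  let V : set R^o := graded_piece (phi \o pi) 1 in
  exists r : nat,
    [/\ socle_dim (phi \o pi) r,
        has_dim V r.+1 &
        exists (O : set (set R^o)) (M : set R^o -> nat -> lmodType R),
          [/\ O !=set0 /\ zariski_open V O,
              (forall p n, O p -> (0 < n)%N ->
                 indecomposable (M p n) /\ minimally_generated_by (M p n) n),
              (forall p n, O p -> (0 < n)%N -> gdim_zero (M p n)) &
              (forall p n p' n', O p -> (0 < n)%N -> O p' -> (0 < n')%N ->
                 (p, n) <> (p', n') -> ~ isomorphic (M p n) (M p' n'))]].
Proof.
move=> V.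
have [x x_mult] := linear_parameter S_graded S_dim1 S_minmult.
have [y [y1 fE]] := x_mult.2 f f_deg2.
have [r [gamma [beta [gamma_basis beta_basis]]]] :=
  linear_basis_exists S_graded f_deg2 f_reg phi_surj phi_ker x_mult y1 fE.
have r_gt0 : (0 < r)%N.
  rewrite lt0n; apply: contra_notN R_not_gorenstein => /eqP.
  exact: (gorenstein_of_piece2_eq0 S_graded f_deg2 f_reg phi_surj phi_ker x_mult y1 fE
            gamma_basis beta_basis).
have socle t := socleP S_graded f_deg2 f_reg phi_surj phi_ker x_mult y1 fE
  gamma_basis beta_basis t r_gt0.
exists r; split.
- exact: (socle_dim_basis gamma_basis socle r_gt0).
- exists (fun i => phi (beta i)).
  exact: (piece1_basis S_graded f_deg2 phi_ker beta_basis).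
pose O : set (set R^o) := multiplier_lines pi phi.
(* The guard [O p] lets one choice function cover all sets [p], with a dummy triple outside [O]. The
   element [t] and its companions depend on [p] only, not on [n]. *)
pose data (p : set R^o) (d : S * S * (nat -> S)) := O p ->
  [/\ multiplier pi d.1.1, p = line (phi d.1.1), graded_piece pi 1 d.1.2,
      forall c, phi d.1.2 <> c *: phi d.1.1 &
      d.1.1 * d.2 0%N = f /\ forall i, d.1.1 * d.2 i.+1 = - (d.1.2 * d.2 i)].
have data_ex p : exists d, data p d.
  have [[t t_mult pE]|nOp] := pselect (O p); last by exists (0, 0, fun=> 0) => /nOp.
  have [z z1 zt] := transversal_element S_graded f_deg2 phi_ker beta_basis r_gt0 t_mult.
  have [g gP] := cofactor_sequence S_graded f_deg2 t_mult z1.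
  by exists (t, z, g).
have [d dP] := choice data_ex.
(* The cofactor matrix for index [n.-1] has size [n.-1.+1], which is [n] for positive [n]. *)
pose M (p : set R^o) (n : nat) : lmodType R :=
  column_module (map_mx phi (jordan_cofactor (d p).2 n.-1)).
have min_gen p n : O p -> (0 < n)%N -> minimally_generated_by (M p n) n.
  move=> /dP[t_mult _ z1 _ [tg0 tgS]] n_gt0.
  rewrite -[X in minimally_generated_by _ X](prednK n_gt0).
  exact: (member_min_gen S_graded f_deg2 f_reg phi_surj phi_ker n.-1 t_mult z1 tg0 tgS).
exists O, M; split.
- split; first exact: multiplier_lines_neq0 x_mult.
  exact: (multiplier_lines_open S_graded f_deg2 f_reg phi_surj phi_ker x_mult beta_basis).
- move=> p n Op n_gt0; split; last exact: min_gen.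
  have [t_mult _ z1 tz [tg0 tgS]] := dP p Op.
  exact: (member_indecomposable S_graded f_deg2 f_reg phi_surj phi_ker x_mult y1 fE
            beta_basis n.-1 t_mult z1 tz tg0 tgS).
- move=> p n /dP[_ _ _ _ [tg0 tgS]] _.
  exact: (member_gdim f_reg phi_surj phi_ker n.-1 tg0 tgS).
move=> p n p' n' Op n_gt0 Op' n'_gt0 ne iso.
have nn' := minimally_generated_inj iso (min_gen p n Op n_gt0) (min_gen p' n' Op' n'_gt0).
rewrite -nn' in iso ne.
have [t_mult pE z1 _ [tg0 tgS]] := dP p Op.
have [t'_mult p'E z'1 _ [t'g0 t'gS]] := dP p' Op'.
apply: (member_not_isomorphic S_graded f_deg2 f_reg phi_surj phi_ker beta_basis (n := n.-1)
  t_mult z1 tg0 tgS t'_mult z'1 t'g0 t'gS) iso.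
by rewrite -pE -p'E => pp'; apply: ne; rewrite pp'.
Qed.
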